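(* Let $s\in\{2,3,4,6\}$ and let $x$ be a complex number which is not a negative integer. For $0<z<1$ put \[ F(x,z)=\sum_{n=0}^{\infty} z^{n+x}\,\frac{\left(\frac12+x\right)_n\left(\frac1s+x\right)_n\left(\frac{s-1}{s}+x\right)_n}{(1+x)_n^3},\qquad z^{n+x}=z^n e^{x\ln z}. \] Let $q=q(z)=\exp\!\Big(\frac{\partial_x F(x,z)|_{x=0}}{F(0,z)}\Big)$, and regard $z$ as a function of $q$ via the inverse of $z\mapsto q(z)$. Let $\phi(q)=F(x,z(q))/F(0,z(q))$. Then \[ \left(q\frac{d}{dq}\right)^3\phi(q)=\frac{x^3 z^x}{\sqrt{1-z}}\left(\frac{q}{z}\frac{dz}{dq}\right)^2=x^3\,F(0,z)^2\,\sqrt{1-z}\;z^x . \]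
   Context: $(a)_n=a(a+1)\cdots(a+n-1)$ denotes the rising factorial, $(a)_0=1$. The function $\partial_x F(x,z)|_{x=0}$ is the derivative of $F(x,z)$ with respect to $x$ at $x=0$; $q(z)$ is the associated mirror map. All functions of $z$ are viewed as functions of $q$ through $z=z(q)$. *)

(* Defs.v *)
From Stdlib Require Export Reals.
From Coquelicot Require Export Coquelicot.
Open Scope R_scope.

Definition Cexp (w : C) : C :=
  (exp (Re w) * cos (Im w), exp (Re w) * sin (Im w)).

(** [CSeries] and [CDerive] return arbitrary values unless the series converges,
    resp. the function is differentiable. *)
Definition CSeries (a : nat -> C) : C :=
  (Series (fun n => Re (a n)), Series (fun n => Im (a n))).

Definition CDerive (f : R -> C) (t : R) : C :=
  (Derive (fun u => Re (f u)) t, Derive (fun u => Im (f u)) t).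

Definition ex_CDerive (f : R -> C) (t : R) : Prop :=
  @ex_derive R_AbsRing C_R_NormedModule f t.

Fixpoint rising (a : C) (n : nat) : C :=
  match n with
  | O => RtoC 1
  | S m => (rising a m * (a + RtoC (INR m)))%C
  end.

Definition not_negative_integer (x : C) : Prop :=
  forall n : nat, x <> RtoC (- INR (S n)).

(** [z ^ x] for real [z > 0] and complex [x]. *)
Definition Rcpow (z : R) (x : C) : C := Cexp (x * RtoC (ln z))%C.

Definition F_term (s : nat) (x : C) (z : R) (n : nat) : C :=
  (RtoC (z ^ n) * Rcpow z x *
   (rising (RtoC (1 / 2) + x) n * rising (RtoC (1 / INR s) + x) n *
    rising (RtoC ((INR s - 1) / INR s) + x) n / (rising (1 + x) n) ^ 3))%C.

Definition F (s : nat) (x : C) (z : R) : C := CSeries (F_term s x z).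

Definition qC (s : nat) (z : R) : C :=
  Cexp (C_derive (fun x => F s x z) 0 / F s 0 z)%C.

(** For [0 < z < 1] the complex number [qC s z] is in fact real. *)
Definition q (s : nat) (z : R) : R := Re (qC s z).

Definition theta (f : R -> C) (t : R) : C := (RtoC t * CDerive f t)%C.

(** [zq] plays the role of the function [z(q)]. *)
Definition phi (s : nat) (x : C) (zq : R -> R) (t : R) : C :=
  (F s x (zq t) / F s 0 (zq t))%C.

(** [zq] inverts [z |-> q s z] on the image of [0 < z < 1]; its values elsewhere
    are irrelevant. *)
Definition inverse_mirror (s : nat) (zq : R -> R) : Prop :=
  forall z : R, 0 < z < 1 -> zq (q s z) = z.

(** Everything entering the definitions of [q(z)] and [z(q)] makes sense:
    convergence of the series, complex differentiability in [x] at [0],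
    nonvanishing of the denominator, and a real-valued, positive, injective [q]. *)
Definition well_defined (s : nat) : Prop :=
  (forall (x : C) (z : R), not_negative_integer x -> 0 < z < 1 ->
     @ex_series C_AbsRing C_NormedModule (F_term s x z)) /\
  (forall z : R, 0 < z < 1 ->
     @ex_derive C_AbsRing C_NormedModule (fun x => F s x z) (RtoC 0) /\
     F s 0 z <> RtoC 0 /\
     qC s z = RtoC (q s z) /\
     0 < q s z) /\
  (forall z1 z2 : R, 0 < z1 < 1 -> 0 < z2 < 1 -> q s z1 = q s z2 -> z1 = z2).

(* Main.v *)
(** Write D = z d/dz and a = 1/s. The recurrence of the coefficients gives
      (1-z) D^3 F = z (3/2 D^2 F + (a(1-a) + 1/2) D F + a(1-a)/2 F) + x^3 z^x,
    and f0 = F(0,.) and f1 = dF/dx(0,.) = f0 ln z + g solve the homogeneous equation. The latter is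
    a symmetric square: the bilinear form
      B(f,h) = (1-z)(f D^2h + h D^2f - Df Dh) - z/2 (f Dh + h Df) - a(1-a) z f h
    satisfies D B(f0,h) = f0 * (the inhomogeneity of h). Letting z -> 0, B(f0,f0) = 0 and
    B(f0,f1) = 0; eliminating between these two gives a first-order equation for the Wronskian,
    whence f0 Df1 - f1 Df0 = f0 / sqrt(1-z), i.e. q d/dq = f0 sqrt(1-z) D. Applying this operator
    to F/f0 twice produces B(f0,F), and the third application produces x^3 z^x f0^2 sqrt(1-z). *)

From Stdlib Require Import Lra Lia Ranalysis5.
Require Import Defs.

(** * Real power series on the unit disk *)

(** The delicate point is the derivative in the complex parameter x at 0, on which q rests. Termwise
    differentiation is replaced by explicit remainders: term ratios, coefficients and z^x are each
    written as c + d h with an error at most M |h|^2, and the growth in n of the constants for the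
    coefficients is slow enough to sum for a fixed z < 1. The first-order coefficients found in this
    way are those of g. Their equation is the derivative in x, at x = 0, of the coefficient
    recurrence; the source x^3 z^x contributes nothing at first order. The equation has real
    coefficients and z is real, so F is handled as two real functions, with the real and the
    imaginary part of x^3 z^x as sources. The function z(q) is prescribed only on the image of (0,
    1). The Wronskian formula makes q increasing, which gives injectivity, an open image and the
    differentiability of z(q). *)

Definition unit_disk (a : nat -> R) : Prop := forall r, 0 <= r < 1 -> CV_disk a r.

Definition mulN (a : nat -> R) (n : nat) : R := INR n * a n.

Lemma unit_disk_radius (a : nat -> R) (z : R) :
  unit_disk a -> Rabs z < 1 -> Rbar_lt (Rabs z) (CV_radius a).
Proof.
  intros Ha Hz.
  set (r := (Rabs z + 1) / 2).
  assert (Hr : Rabs z < r < 1) by (unfold r; lra).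
  assert (H0 := Rabs_pos z).
  apply Rbar_lt_le_trans with (Finite r); [simpl; lra|].
  apply (proj1 (Lub.Lub_Rbar_correct (CV_disk a))).
  apply Ha; lra.
Qed.

Lemma unit_disk_ex (a : nat -> R) (z : R) : unit_disk a -> Rabs z < 1 -> ex_pseries a z.
Proof. intros Ha Hz; apply CV_radius_inside, unit_disk_radius; assumption. Qed.

Lemma radius_unit_disk (a : nat -> R) : Rbar_le 1 (CV_radius a) -> unit_disk a.
Proof.
  intros Ha r Hr; apply CV_disk_inside.
  apply Rbar_lt_le_trans with (Finite 1); [|exact Ha].
  simpl; rewrite Rabs_pos_eq; lra.
Qed.

Lemma unit_disk_radius_1 (a : nat -> R) : unit_disk a -> Rbar_le 1 (CV_radius a).
Proof.
  intros Ha.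
  apply Rbar_not_lt_le; intros H.
  assert (H0 := CV_radius_ge_0 a).
  destruct (CV_radius a) as [c| |] eqn:E; simpl in H, H0; try contradiction.
  assert (H1 := unit_disk_radius a c Ha).
  rewrite E in H1; rewrite (Rabs_pos_eq c H0) in H1.
  specialize (H1 H); simpl in H1; lra.
Qed.

Lemma unit_disk_ext (a b : nat -> R) : (forall n, a n = b n) -> unit_disk a -> unit_disk b.
Proof.
  intros E Ha r Hr; apply ex_series_ext with (2 := Ha r Hr).
  intros n; simpl; rewrite E; reflexivity.
Qed.

Lemma unit_disk_le (a b : nat -> R) :
  (forall n, Rabs (a n) <= Rabs (b n)) -> unit_disk b -> unit_disk a.
Proof.
  intros E Hb r Hr; apply (@ex_series_le R_AbsRing R_CompleteNormedModule) with (2 := Hb r Hr).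
  intros n; change (Rabs (Rabs (a n * r ^ n)) <= Rabs (b n * r ^ n)).
  rewrite Rabs_Rabsolu, !Rabs_mult.
  apply Rmult_le_compat_r; [apply Rabs_pos|apply E].
Qed.

Lemma unit_disk_plus (a b : nat -> R) :
  unit_disk a -> unit_disk b -> unit_disk (fun n => a n + b n).
Proof. intros Ha Hb r Hr; apply (CV_disk_plus a b); auto. Qed.

Lemma unit_disk_scal (c : R) (a : nat -> R) : unit_disk a -> unit_disk (fun n => c * a n).
Proof. intros Ha r Hr; apply (CV_disk_scal c a); auto. Qed.

Lemma mulN_incr (a : nat -> R) (n : nat) : PS_incr_1 (PS_derive a) n = mulN a n.
Proof.
  destruct n as [|n]; [unfold mulN; simpl; rewrite Rmult_0_l; reflexivity|reflexivity].
Qed.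

Lemma unit_disk_mulN (a : nat -> R) : unit_disk a -> unit_disk (mulN a).
Proof.
  intros Ha; apply unit_disk_ext with (1 := mulN_incr a), radius_unit_disk.
  rewrite CV_radius_incr_1, CV_radius_derive.
  apply unit_disk_radius_1, Ha.
Qed.

Lemma unit_disk_1 : unit_disk (fun _ => 1).
Proof.
  intros r Hr.
  apply ex_series_ext with (fun n => r ^ n).
  - intros n; rewrite Rmult_1_l, Rabs_pos_eq; [reflexivity|apply pow_le; lra].
  - apply ex_series_geom; rewrite Rabs_pos_eq; lra.
Qed.

(** The radius of convergence is also the supremum of the r for which [a n * r ^ n] stays bounded. A
    radius c < 1 is refuted at the midpoint of c and 1. *)
Lemma unit_disk_bounded (a : nat -> R) :
  (forall r, 0 < r < 1 -> exists M, forall n, Rabs (a n) * r ^ n <= M) -> unit_disk a.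
Proof.
  intros H; apply radius_unit_disk.
  apply Rbar_not_lt_le; intros Hlt.
  assert (H0 := CV_radius_ge_0 a).
  destruct (CV_radius a) as [c| |] eqn:E; simpl in Hlt, H0; try contradiction.
  assert (Hl := proj1 (CV_radius_bounded a)); rewrite E in Hl.
  destruct (H ((c + 1) / 2)) as [M HM]; [lra|].
  specialize (Hl ((c + 1) / 2)).
  assert (Hb : Rbar_le ((c + 1) / 2) c); [|simpl in Hb; lra].
  apply Hl; exists M; intros n.
  rewrite Rabs_mult, (Rabs_pos_eq (_ ^ n)); [apply HM|apply pow_le; lra].
Qed.

Lemma is_derive_PSeries_mulN (a : nat -> R) (z : R) :
  unit_disk a -> 0 < z < 1 -> is_derive (PSeries a) z (PSeries (mulN a) z / z).
Proof.
  intros Ha Hz.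
  assert (E : PSeries (mulN a) z / z = PSeries (PS_derive a) z).
  { rewrite <- (PSeries_ext _ _ z (mulN_incr a)), PSeries_incr_1; field; lra. }
  rewrite E; apply is_derive_PSeries, unit_disk_radius; [exact Ha|].
  rewrite Rabs_pos_eq; lra.
Qed.

(** Four terms because the coefficient recurrence has four; shorter combinations are padded with the
    zero sequence. *)
Lemma PSeries_lin (u v w t : R) (a b c d : nat -> R) (z : R) :
  unit_disk a -> unit_disk b -> unit_disk c -> unit_disk d -> Rabs z < 1 ->
  PSeries (fun n => u * a n + v * b n + w * c n + t * d n) z =
  u * PSeries a z + v * PSeries b z + w * PSeries c z + t * PSeries d z.
Proof.
  intros Ha Hb Hc Hd Hz.
  pose proof (unit_disk_scal u a Ha) as Ha'; pose proof (unit_disk_scal v b Hb) as Hb'.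
  pose proof (unit_disk_scal w c Hc) as Hc'; pose proof (unit_disk_scal t d Hd) as Hd'.
  pose proof (unit_disk_plus _ _ Ha' Hb') as Hab.
  pose proof (unit_disk_plus _ _ Hab Hc') as Habc.
  transitivity (PSeries (PS_plus (PS_plus (PS_plus (PS_scal u a) (PS_scal v b)) (PS_scal w c))
    (PS_scal t d)) z); [reflexivity|].
  rewrite !PSeries_plus, !PSeries_scal; try reflexivity; apply unit_disk_ex; assumption.
Qed.

Lemma PSeries_shift (c d : nat -> R) (z : R) :
  unit_disk c -> Rabs z < 1 -> (forall n, c (S n) = d n) ->
  PSeries c z = c 0%nat + z * PSeries d z.
Proof.
  intros Hc Hz E.
  rewrite PSeries_decr_1 by (apply unit_disk_ex; assumption).
  f_equal; f_equal; apply PSeries_ext; exact E.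
Qed.

(** This turns a recurrence for coefficients into a differential equation. The index-0 coefficient
    has no predecessor and becomes the source term. *)
Lemma PSeries_shift_lin (u v w t : R) (e a b c d : nat -> R) (z : R) :
  unit_disk e -> unit_disk a -> unit_disk b -> unit_disk c -> unit_disk d -> Rabs z < 1 ->
  (forall n, e (S n) = u * a n + v * b n + w * c n + t * d n) ->
  PSeries e z =
  e 0%nat + z * (u * PSeries a z + v * PSeries b z + w * PSeries c z + t * PSeries d z).
Proof.
  intros He Ha Hb Hc Hd Hz E.
  rewrite (PSeries_shift e _ z He Hz E), PSeries_lin; auto.
Qed.

Lemma PSeries_nonneg (a : nat -> R) (z : R) :
  unit_disk a -> (forall n, 0 <= a n) -> 0 <= z < 1 -> a 0%nat <= PSeries a z.
Proof.
  intros Ha Hp Hz.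
  assert (Hz' : Rabs z < 1) by (rewrite Rabs_pos_eq; lra).
  rewrite PSeries_decr_1 by (apply unit_disk_ex; assumption).
  assert (0 <= PSeries (PS_decr_1 a) z); [|nra].
  unfold PSeries.
  rewrite <- (Rmult_0_l (Series (fun n => 0))), <- Series_scal_l.
  apply Series_le.
  - intros n; unfold PS_decr_1; split; [lra|]. rewrite Rmult_0_l.
    apply Rmult_le_pos; [apply Hp|apply pow_le; lra].
  - assert (H := unit_disk_radius a z Ha Hz'); rewrite <- CV_radius_decr_1 in H.
    apply CV_radius_inside, ex_pseries_R in H; exact H.
Qed.

(** * Hypergeometric coefficients: term ratios and growth *)

Definition factor (al : R) (w : C) : C := ((RtoC al + w) / (1 + w))%C.

Definition ratio (a : R) (w : C) : C :=
  (factor (1 / 2) w * factor a w * factor (1 - a) w)%C.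

Definition coef (a : R) (x : C) (n : nat) : C :=
  (rising (RtoC (1 / 2) + x) n * rising (RtoC a + x) n * rising (RtoC (1 - a) + x) n /
   rising (1 + x) n ^ 3)%C.

Lemma succ_shift_neq_0 (x : C) (n : nat) :
  not_negative_integer x -> (1 + (x + RtoC (INR n)))%C <> RtoC 0.
Proof.
  intros Hx E; apply (Hx n).
  replace x with ((1 + (x + RtoC (INR n))) - RtoC (1 + INR n))%C
    by (rewrite RtoC_plus; ring).
  rewrite E, S_INR, <- RtoC_minus; f_equal; ring.
Qed.

Lemma rising_neq_0 (x : C) (n : nat) :
  not_negative_integer x -> rising (1 + x) n <> RtoC 0.
Proof.
  intros Hx; induction n as [|n IH]; simpl.
  - intros E; apply RtoC_inj in E; lra.
  - apply Cmult_neq_0; [exact IH|].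
    replace (1 + x + RtoC (INR n))%C with (1 + (x + RtoC (INR n)))%C by ring.
    apply succ_shift_neq_0, Hx.
Qed.

Lemma coef_0 (a : R) (x : C) : coef a x 0 = RtoC 1.
Proof. unfold coef; simpl; field; intros E; apply RtoC_inj in E; lra. Qed.

Lemma coef_S (a : R) (x : C) (n : nat) : not_negative_integer x ->
  coef a x (S n) = (coef a x n * ratio a (x + RtoC (INR n)))%C.
Proof.
  intros Hx.
  assert (H1 := rising_neq_0 x n Hx).
  assert (H2 := succ_shift_neq_0 x n Hx).
  unfold coef, ratio, factor; simpl.
  field; auto.
Qed.

Lemma factor_decomp (al : R) (w : C) : (1 + w)%C <> RtoC 0 ->
  factor al w = (1 - RtoC (1 - al) / (1 + w))%C.
Proof. intros H; unfold factor; rewrite RtoC_minus; field; exact H. Qed.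

Lemma Cmod_factor (al : R) (w : C) : 0 < al < 1 -> (1 + w)%C <> RtoC 0 ->
  Cmod (factor al w) <= 1 + / Cmod (1 + w).
Proof.
  intros Hal H; rewrite factor_decomp by exact H.
  unfold Cminus.
  eapply Rle_trans; [apply Cmod_triangle|].
  rewrite Cmod_opp, Cmod_div, !Cmod_R, Rabs_R1, Rabs_pos_eq by (auto; lra).
  apply Rplus_le_compat_l.
  assert (0 < Cmod (1 + w)) by (apply Cmod_gt_0; exact H).
  unfold Rdiv; assert (0 < / Cmod (1 + w)) by (apply Rinv_0_lt_compat; assumption).
  nra.
Qed.

Lemma Cmod_succ_shift (x : C) (n : nat) :
  INR n + 1 - Cmod x <= Cmod (1 + (x + RtoC (INR n))).
Proof.
  replace (1 + (x + RtoC (INR n)))%C with (RtoC (INR n + 1) - (- x))%C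
    by (rewrite RtoC_plus; ring).
  assert (H := Cmod_triangle (RtoC (INR n + 1) - - x) (- x)).
  replace (RtoC (INR n + 1) - - x + - x)%C with (RtoC (INR n + 1)) in H by ring.
  rewrite Cmod_opp, Cmod_R, Rabs_pos_eq in H by (assert (H0 := pos_INR n); lra).
  lra.
Qed.

(** Each of the three factors is 1 + O(1/n), so the ratio tends to 1 and eventually drops below
    1/r. *)
Lemma Cmod_ratio_eventually (a : R) (x : C) (r : R) :
  0 < a < 1 -> not_negative_integer x -> 0 < r < 1 ->
  exists N, forall n, (N <= n)%nat -> Cmod (ratio a (x + RtoC (INR n))) * r <= 1.
Proof.
  intros Ha Hx Hr.
  (* For 0 <= d <= 1 one has (1 + d)^3 <= 1 + 7 d, so this d makes the product of three factors of
     size at most 1 + d no larger than 1/r. *)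
  set (d := Rmin 1 ((/ r - 1) / 7)).
  assert (Hr1 : 1 < / r) by (rewrite <- Rinv_1; apply Rinv_lt_contravar; lra).
  assert (Hd : 0 < d) by (apply Rmin_glb_lt; lra).
  assert (Hd1 : d <= 1) by apply Rmin_l.
  assert (Hd2 : d <= (/ r - 1) / 7) by apply Rmin_r.
  (* N + 1 exceeds |x| + 1/d, and |1 + x + n| >= n + 1 - |x|, so it exceeds 1/d from N on. *)
  destruct (nfloor_ex (Cmod x + / d)) as [N HN].
  { assert (H := Cmod_ge_0 x); assert (0 < / d) by (apply Rinv_0_lt_compat; lra); lra. }
  exists N; intros n Hn.
  assert (HnN : INR N <= INR n) by (apply le_INR; exact Hn).
  assert (Hw := Cmod_succ_shift x n).
  set (w := (x + RtoC (INR n))%C) in *.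
  assert (Hw0 : (1 + w)%C <> RtoC 0) by apply succ_shift_neq_0, Hx.
  assert (0 < / d) by (apply Rinv_0_lt_compat; lra).
  assert (Hi : / Cmod (1 + w) <= d).
  { rewrite <- (Rinv_inv d); apply Rinv_le_contravar; lra. }
  assert (F1 := Cmod_factor (1 / 2) w ltac:(lra) Hw0).
  assert (F2 := Cmod_factor a w Ha Hw0).
  assert (F3 := Cmod_factor (1 - a) w ltac:(lra) Hw0).
  unfold ratio; rewrite !Cmod_mult.
  assert (P1 := Cmod_ge_0 (factor (1 / 2) w)).
  assert (P2 := Cmod_ge_0 (factor a w)).
  assert (P3 := Cmod_ge_0 (factor (1 - a) w)).
  assert (Q : Cmod (factor (1 / 2) w) * Cmod (factor a w) * Cmod (factor (1 - a) w)
              <= (1 + d) * (1 + d) * (1 + d)).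
  { apply Rmult_le_compat; try lra; [apply Rmult_le_pos; lra|].
    apply Rmult_le_compat; lra. }
  assert (Q2 : (1 + d) * (1 + d) * (1 + d) <= / r) by nra.
  apply Rle_trans with (/ r * r); [apply Rmult_le_compat_r; lra|].
  rewrite Rinv_l; lra.
Qed.

(** For each r < 1 the sequence [Cmod (coef a x n) * r ^ n] is nonincreasing from some index on,
    hence bounded. *)
Lemma unit_disk_coef (a : R) (x : C) : 0 < a < 1 -> not_negative_integer x ->
  unit_disk (fun n => Cmod (coef a x n)).
Proof.
  intros Ha Hx; apply unit_disk_bounded; intros r Hr.
  destruct (Cmod_ratio_eventually a x r Ha Hx Hr) as [N HN].
  assert (HN' : forall n, (N <= n)%nat ->
    Cmod (coef a x n) * r ^ n <= Cmod (coef a x N) * r ^ N).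
  { intros n Hn; induction Hn as [|n Hn IH]; [lra|].
    eapply Rle_trans; [|exact IH].
    rewrite coef_S, Cmod_mult by exact Hx; simpl.
    replace (Cmod (coef a x n) * Cmod (ratio a (x + RtoC (INR n))) * (r * r ^ n))
      with (Cmod (coef a x n) * r ^ n * (Cmod (ratio a (x + RtoC (INR n))) * r)) by ring.
    rewrite <- (Rmult_1_r (Cmod (coef a x n) * r ^ n)) at 2.
    apply Rmult_le_compat_l; [|apply HN, Hn].
    apply Rmult_le_pos; [apply Cmod_ge_0|apply pow_le; lra]. }
  assert (HB : forall K, exists M, forall n, (n <= K)%nat -> Cmod (coef a x n) * r ^ n <= M).
  { induction K as [|K [M HM]].
    - exists (Cmod (coef a x 0) * r ^ 0); intros n Hn.
      replace n with 0%nat by lia; lra.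
    - exists (Rmax M (Cmod (coef a x (S K)) * r ^ S K)); intros n Hn.
      destruct (Nat.eq_dec n (S K)) as [->|E]; [apply Rmax_r|].
      eapply Rle_trans; [apply HM; lia|apply Rmax_l]. }
  destruct (HB N) as [M HM].
  exists M; intros n; rewrite Rabs_pos_eq by apply Cmod_ge_0.
  destruct (Nat.le_gt_cases n N) as [H|H]; [apply HM, H|].
  eapply Rle_trans; [apply HN'; lia|apply HM; lia].
Qed.

(** * The symmetric-square equation *)

(** [f i] stands for [(z d/dz)^i (f 0)]. *)
Definition chain (f : nat -> R -> R) : Prop :=
  forall i z, 0 < z < 1 -> is_derive (f i) z (f (S i) z / z).

Definition solves (a : R) (h : R -> R) (f : nat -> R -> R) : Prop :=
  forall z, 0 < z < 1 ->
  (1 - z) * f 3%nat z =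
  z * (3 / 2 * f 2%nat z + (a * (1 - a) + 1 / 2) * f 1%nat z + a * (1 - a) / 2 * f 0%nat z) + h z.

(** The equation [solves a 0] is a symmetric square, so its solutions carry an invariant
    quadratic form; this is the polar form. *)
Definition bil (a : R) (f g : nat -> R -> R) (z : R) : R :=
  (1 - z) * (f 0%nat z * g 2%nat z + f 2%nat z * g 0%nat z - f 1%nat z * g 1%nat z)
  - z / 2 * (f 0%nat z * g 1%nat z + f 1%nat z * g 0%nat z)
  - a * (1 - a) * z * (f 0%nat z * g 0%nat z).

Lemma chain_ex (f : nat -> R -> R) (i : nat) (z : R) :
  chain f -> 0 < z < 1 -> ex_derive (f i) z.
Proof. intros Hf Hz; eexists; apply Hf, Hz. Qed.

Lemma chain_Derive (f : nat -> R -> R) (i : nat) (z : R) :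
  chain f -> 0 < z < 1 -> Derive (fun u => f i u) z = f (S i) z / z.
Proof. intros Hf Hz; apply is_derive_unique, Hf, Hz. Qed.

(** Under [z d/dz] the mixed terms f1 g2 and f2 g1 with factor 1 - z cancel, and the third-order
    terms are f0 (1-z) g3 + g0 (1-z) f3. Substituting both equations cancels everything except f0
    h. *)
Lemma is_derive_bil (a : R) (h : R -> R) (f g : nat -> R -> R) (z : R) :
  chain f -> chain g -> solves a (fun _ => 0) f -> solves a h g -> 0 < z < 1 ->
  is_derive (bil a f g) z (f 0%nat z * h z / z).
Proof.
  intros Hf Hg Sf Sg Hz.
  unfold bil; auto_derive.
  - repeat split; apply chain_ex; assumption.
  - rewrite !(chain_Derive f), !(chain_Derive g) by assumption.
    specialize (Sf z Hz); specialize (Sg z Hz).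
    assert (Hh : h z = (1 - z) * g 3%nat z - z * (3 / 2 * g 2%nat z +
      (a * (1 - a) + 1 / 2) * g 1%nat z + a * (1 - a) / 2 * g 0%nat z)) by lra.
    rewrite Hh; clear Sg Hh.
    assert (Hf3 : f 3%nat z = (z * (3 / 2 * f 2%nat z +
      (a * (1 - a) + 1 / 2) * f 1%nat z + a * (1 - a) / 2 * f 0%nat z)) / (1 - z)).
    { field_simplify_eq; lra. }
    rewrite Hf3; field; lra.
Qed.

(** J and K are kept apart because J may contain a logarithm; K is an expression for the same values
    that is continuous at 0, where the constant can be read off. *)
Lemma const_limit_0 (J K : R -> R) (z : R) :
  (forall u, 0 < u < 1 -> is_derive J u 0) -> (forall u, 0 < u < 1 -> K u = J u) ->
  continuity_pt K 0 -> 0 < z < 1 -> K z = K 0.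
Proof.
  intros HJ E HK Hz.
  assert (HE : forall u, 0 < u < 1 -> K u = K z).
  { intros u Hu; rewrite (E u Hu), (E z Hz).
    destruct (MVT_gen J z u (fun _ => 0)) as [c [_ Hc]].
    - intros w Hw; apply HJ.
      unfold Rmin, Rmax in Hw; destruct (Rle_dec z u); lra.
    - intros w Hw.
      apply continuity_pt_filterlim, (ex_derive_continuous J).
      exists 0; apply HJ; unfold Rmin, Rmax in Hw; destruct (Rle_dec z u); lra.
    - lra. }
  destruct (Req_dec (K z) (K 0)) as [H|H]; [exact H|exfalso].
  (* With the distance itself as epsilon, a point u near 0 with K u = K z gives a number less than
     itself. *)
  destruct (HK (Rabs (K z - K 0))) as [d [Hd Hd']].
  { apply Rabs_pos_lt; lra. }
  set (u := Rmin (d / 2) (1 / 2)).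
  assert (Hu : 0 < u) by (apply Rmin_glb_lt; lra).
  assert (Hu1 : u <= 1 / 2) by apply Rmin_r.
  assert (Hu2 : u <= d / 2) by apply Rmin_l.
  specialize (Hd' u).
  simpl in Hd'; unfold R_dist in Hd'.
  rewrite (HE u) in Hd' by lra.
  apply (Rlt_irrefl (Rabs (K z - K 0))), Hd'.
  split; [split; [exact I|lra]|].
  rewrite Rminus_0_r, Rabs_pos_eq; lra.
Qed.

(** The two solutions at the singular point [z = 0] are [y] and [ln z * y + g]. *)
Record frobenius_basis (a : R) (y g : nat -> R -> R) : Prop := {
  fb_y : chain y;
  fb_g : chain g;
  fb_ode_y : solves a (fun _ => 0) y;
  fb_ode_g : forall z, 0 < z < 1 ->
    (1 - z) * (3 * y 2%nat z + g 3%nat z) =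
    z * (3 / 2 * (2 * y 1%nat z + g 2%nat z) + (a * (1 - a) + 1 / 2) * (y 0%nat z + g 1%nat z)
         + a * (1 - a) / 2 * g 0%nat z);
  fb_cont_y : forall i, continuity_pt (y i) 0;
  fb_cont_g : forall i, continuity_pt (g i) 0;
  fb_y0_0 : y 0%nat 0 = 1;
  fb_yS_0 : forall i, y (S i) 0 = 0;
  fb_g_0 : forall i, g i 0 = 0;
  fb_pos : forall z, 0 < z < 1 -> 0 < y 0%nat z }.

(** The jet of [ln z * y + g]. *)
Definition log_jet (y g : nat -> R -> R) (i : nat) (z : R) : R :=
  ln z * y i z + INR i * y (pred i) z + g i z.

Lemma chain_log_jet (y g : nat -> R -> R) : chain y -> chain g -> chain (log_jet y g).
Proof.
  intros Hy Hg i z Hz; unfold log_jet.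
  auto_derive.
  - repeat split; try apply chain_ex; try assumption; lra.
  - rewrite !(chain_Derive y), !(chain_Derive g), S_INR by assumption.
    (* For i = 0 the junk value [pred 0 = 0] is harmless, since its factor [INR 0] vanishes. *)
    destruct i as [|i]; simpl pred; [simpl INR|]; field; lra.
Qed.

(** The terms with ln z cancel by the equation of y; the terms without it are exactly [fb_ode_g]. *)
Lemma solves_log_jet (a : R) (y g : nat -> R -> R) :
  frobenius_basis a y g -> solves a (fun _ => 0) (log_jet y g).
Proof.
  intros H z Hz; unfold log_jet.
  assert (Ey := fb_ode_y _ _ _ H z Hz).
  assert (Eg := fb_ode_g _ _ _ H z Hz).
  simpl pred; simpl INR.
  replace ((1 - z) * (ln z * y 3%nat z + (1 + 1 + 1) * y 2%nat z + g 3%nat z)) with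
    (ln z * ((1 - z) * y 3%nat z) + (1 - z) * (3 * y 2%nat z + g 3%nat z)) by ring.
  rewrite Ey, Eg; field.
Qed.

Ltac cont := repeat first
  [ assumption
  | apply continuity_pt_minus | apply continuity_pt_plus | apply continuity_pt_mult
  | apply continuity_pt_const; intros ? ?; reflexivity
  | apply continuity_pt_id ].

(** The form is constant, and at z = 0 each of its terms carries a factor z, [y 1] or [y 2], all of
    which vanish there. *)
Lemma bil_self (a : R) (y g : nat -> R -> R) (z : R) :
  frobenius_basis a y g -> 0 < z < 1 -> bil a y y z = 0.
Proof.
  intros H Hz.
  rewrite (const_limit_0 (bil a y y) (bil a y y) z).
  - unfold bil; rewrite !(fb_yS_0 _ _ _ H); ring.
  - intros u Hu.
    replace 0 with (y 0%nat u * 0 / u) by (field; lra).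
    apply (is_derive_bil a (fun _ => 0)); try apply H; exact Hu.
  - reflexivity.
  - assert (C0 := fb_cont_y _ _ _ H 0); assert (C1 := fb_cont_y _ _ _ H 1).
    assert (C2 := fb_cont_y _ _ _ H 2).
    unfold bil; cont.
  - exact Hz.
Qed.

(** What remains of [bil y (log_jet y g)] once [bil y y = 0] has removed the logarithm. *)
Definition bil_log (a : R) (y g : nat -> R -> R) (z : R) : R :=
  (1 - z) * (y 0%nat z * (2 * y 1%nat z + g 2%nat z) + y 2%nat z * g 0%nat z
             - y 1%nat z * (y 0%nat z + g 1%nat z))
  - z * (1 / 2) * (y 0%nat z * (y 0%nat z + g 1%nat z) + y 1%nat z * g 0%nat z)
  - a * (1 - a) * z * (y 0%nat z * g 0%nat z).

Lemma bil_log_0 (a : R) (y g : nat -> R -> R) (z : R) :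
  frobenius_basis a y g -> 0 < z < 1 -> bil_log a y g z = 0.
Proof.
  intros H Hz.
  rewrite (const_limit_0 (bil a y (log_jet y g)) (bil_log a y g) z).
  - unfold bil_log; rewrite !(fb_yS_0 _ _ _ H), !(fb_g_0 _ _ _ H); ring.
  - intros u Hu.
    replace 0 with (y 0%nat u * 0 / u) by (field; lra).
    apply (is_derive_bil a (fun _ => 0)); try apply H; try exact Hu.
    + apply chain_log_jet; apply H.
    + apply solves_log_jet, H.
  (* The coefficient of ln u in the full form is [bil a y y u], so dropping the logarithm changes no
     value on (0, 1). *)
  - intros u Hu; assert (B := bil_self a y g u H Hu).
    transitivity (bil_log a y g u + ln u * bil a y y u); [rewrite B; ring|].
    unfold bil_log, bil, log_jet; simpl pred; simpl INR; field.
  - assert (C0 := fb_cont_y _ _ _ H 0); assert (C1 := fb_cont_y _ _ _ H 1).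
    assert (C2 := fb_cont_y _ _ _ H 2); assert (D0 := fb_cont_g _ _ _ H 0).
    assert (D1 := fb_cont_g _ _ _ H 1); assert (D2 := fb_cont_g _ _ _ H 2).
    unfold bil_log; cont.
  - exact Hz.
Qed.

(** This is y Df1 - f1 Dy for f1 = ln z y + g; the logarithm cancels, so it makes sense at z = 0. *)
Definition wronskian (y g : nat -> R -> R) (z : R) : R :=
  y 0%nat z * y 0%nat z + y 0%nat z * g 1%nat z - g 0%nat z * y 1%nat z.

Lemma wronskian_eq (a : R) (y g : nat -> R -> R) (z : R) :
  frobenius_basis a y g -> 0 < z < 1 -> wronskian y g z = y 0%nat z / sqrt (1 - z).
Proof.
  intros H Hz.
  (* The first-order equation is (1-z)(y DW - W Dy) = (z/2) y W, whose solutions are the multiples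
     of y / sqrt(1-z). J is that multiple, and its value at 0 is 1. *)
  set (J := fun z => wronskian y g z * sqrt (1 - z) / y 0%nat z).
  assert (HJ : J z = 1).
  { rewrite (const_limit_0 J J z).
    - unfold J, wronskian; rewrite !(fb_yS_0 _ _ _ H), !(fb_g_0 _ _ _ H), (fb_y0_0 _ _ _ H).
      rewrite Rminus_0_r, sqrt_1; field.
    - intros u Hu; unfold J, wronskian.
      assert (Hy := fb_y _ _ _ H); assert (Hg := fb_g _ _ _ H).
      assert (Hp := fb_pos _ _ _ H u Hu).
      auto_derive.
      + repeat split; try (apply chain_ex; assumption); lra.
      + rewrite !(chain_Derive y), !(chain_Derive g) by assumption.
        assert (B0 := bil_self a y g u H Hu); assert (B1 := bil_log_0 a y g u H Hu).
        unfold bil in B0; unfold bil_log in B1.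
        assert (Hs : 0 < sqrt (1 - u)) by (apply sqrt_lt_R0; lra).
        assert (Hs2 : 1 - u = sqrt (1 - u) * sqrt (1 - u)) by (rewrite sqrt_sqrt; lra).
        change (1 + - u) with (1 - u).
        set (s := sqrt (1 - u)) in *.
        apply Rmult_eq_reg_r with (u * (2 * s) * (y 0%nat u * y 0%nat u * y 0%nat u)).
        2:{ repeat apply Rmult_integral_contrapositive_currified; lra. }
        rewrite Rmult_0_l.
        (* The combination y [bil_log] - g [bil a y y] eliminates the term with a(1-a) and equals
           (1-u)(y DW - W Dy) - (u/2) y W. Times 2 y, this is the derivative of J with its
           denominators cleared. *)
        transitivity (2 * (y 0%nat u * ((1 - u) * (y 0%nat u * (2 * y 1%nat u + g 2%nat u)
          + y 2%nat u * g 0%nat u - y 1%nat u * (y 0%nat u + g 1%nat u))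
            - u * (1 / 2) * (y 0%nat u * (y 0%nat u + g 1%nat u) + y 1%nat u * g 0%nat u)
            - a * (1 - a) * u * (y 0%nat u * g 0%nat u)) - 
            g 0%nat u * ((1 - u) * (y 0%nat u * y 2%nat u + y 2%nat u * y 0%nat u - y 1%nat u * y 1%nat u)
              - u / 2 * (y 0%nat u * y 1%nat u + y 1%nat u * y 0%nat u)
              - a * (1 - a) * u * (y 0%nat u * y 0%nat u)))
           * y 0%nat u).
        2:{ rewrite B0, B1; ring. }
        rewrite Hs2; field; lra.
    - reflexivity.
    - assert (C0 := fb_cont_y _ _ _ H 0); assert (C1 := fb_cont_y _ _ _ H 1).
      assert (D0 := fb_cont_g _ _ _ H 0); assert (D1 := fb_cont_g _ _ _ H 1).
      unfold J, wronskian.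
      apply continuity_pt_div; [|exact C0|rewrite (fb_y0_0 _ _ _ H); lra].
      apply continuity_pt_mult; [cont|].
      apply (continuity_pt_comp (fun u => 1 - u) sqrt); [cont|].
      apply continuity_pt_sqrt; lra.
    - exact Hz. }
  assert (Hp := fb_pos _ _ _ H z Hz).
  assert (Hs : 0 < sqrt (1 - z)) by (apply sqrt_lt_R0; lra).
  unfold J in HJ.
  transitivity ((wronskian y g z * sqrt (1 - z) / y 0%nat z) * (y 0%nat z / sqrt (1 - z))).
  - field; lra.
  - rewrite HJ; ring.
Qed.

(** * Inverting a monotone function on (0, 1) *)

Lemma increasing_01 (f df : R -> R) :
  (forall z, 0 < z < 1 -> is_derive f z (df z)) -> (forall z, 0 < z < 1 -> 0 < df z) ->
  forall u v, 0 < u -> u < v -> v < 1 -> f u < f v.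
Proof.
  intros Hf Hp u v Hu Huv Hv.
  destruct (MVT_gen f u v df) as [c [Hc E]].
  - intros w; rewrite Rmin_left, Rmax_right by lra; intros Hw; apply Hf; lra.
  - intros w; rewrite Rmin_left, Rmax_right by lra; intros Hw.
    apply continuity_pt_filterlim, (ex_derive_continuous f).
    exists (df w); apply Hf; lra.
  - rewrite Rmin_left, Rmax_right in Hc by lra.
    assert (0 < df c) by (apply Hp; lra).
    assert (0 < df c * (v - u)) by (apply Rmult_lt_0_compat; lra); lra.
Qed.

Lemma continuity_01 (f df : R -> R) (z : R) :
  (forall z, 0 < z < 1 -> is_derive f z (df z)) -> 0 < z < 1 -> continuity_pt f z.
Proof.
  intros Hf Hz; apply continuity_pt_filterlim, (ex_derive_continuous f).
  exists (df z); apply Hf, Hz.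
Qed.

(** An inverse is known only on the image, so identities between functions of t = f z can be
    differentiated only once the image is a neighbourhood of f z. The intermediate value theorem
    between z/2 and (z+1)/2 provides this. *)
Lemma locally_image (f df : R -> R) (z : R) :
  (forall z, 0 < z < 1 -> is_derive f z (df z)) -> (forall z, 0 < z < 1 -> 0 < df z) ->
  0 < z < 1 -> locally (f z) (fun t => exists u, 0 < u < 1 /\ t = f u).
Proof.
  intros Hf Hp Hz.
  assert (I1 := increasing_01 f df Hf Hp (z / 2) z ltac:(lra) ltac:(lra) ltac:(lra)).
  assert (I2 := increasing_01 f df Hf Hp z ((z + 1) / 2) ltac:(lra) ltac:(lra) ltac:(lra)).
  set (e := Rmin (f z - f (z / 2)) (f ((z + 1) / 2) - f z)).
  assert (He : 0 < e) by (apply Rmin_glb_lt; lra).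
  exists (mkposreal e He); intros t Ht.
  change (Rabs (t - f z) < e) in Ht.
  assert (e <= f z - f (z / 2)) by apply Rmin_l.
  assert (e <= f ((z + 1) / 2) - f z) by apply Rmin_r.
  apply Rabs_def2 in Ht.
  destruct (f_interv_is_interv f (z / 2) ((z + 1) / 2) t) as [u [Hu E]]; try lra.
  - intros w Hw; apply (continuity_01 f df w Hf); lra.
  - exists u; split; [lra|symmetry; exact E].
Qed.

(** The inverse function theorem used here lives on a closed interval, so (0, 1) is cut down to
    [l, u] around z. Continuity of k at f z comes first, from the monotonicity of f. *)
Lemma is_derive_inverse (f df k : R -> R) (z : R) :
  (forall z, 0 < z < 1 -> is_derive f z (df z)) -> (forall z, 0 < z < 1 -> 0 < df z) ->
  (forall z, 0 < z < 1 -> k (f z) = z) ->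
  0 < z < 1 -> is_derive k (f z) (/ df z).
Proof.
  intros Hf Hp Hk Hz.
  assert (Inc := increasing_01 f df Hf Hp).
  set (l := z / 2); set (u := (z + 1) / 2).
  assert (Hl : 0 < l < z) by (unfold l; lra).
  assert (Hu : z < u < 1) by (unfold u; lra).
  assert (I1 : f l < f z) by (apply Inc; lra).
  assert (I2 : f z < f u) by (apply Inc; lra).
  assert (Prf : forall a, k (f l) <= a <= k (f u) -> derivable_pt f a).
  { intros a Ha; rewrite !Hk in Ha by lra.
    apply ex_derive_Reals_0; exists (df a); apply Hf; lra. }
  assert (Cont : continuity_pt k (f z)).
  { apply (continuity_pt_recip_prelim f k l u); try lra.
    - intros v w Hv Hvw Hw; apply Inc; lra.
    - intros v Hv; unfold comp, id; apply Hk; lra.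
    - intros v Hv; apply (continuity_01 f df v Hf); lra. }
  assert (Prg : k (f l) <= k (f z) <= k (f u)) by (rewrite !Hk by lra; lra).
  assert (D : derive_pt f (k (f z)) (Prf (k (f z)) Prg) = df z).
  { rewrite Derive_Reals; apply is_derive_unique.
    rewrite Hk by lra; apply Hf, Hz. }
  apply is_derive_Reals.
  replace (/ df z) with (1 / derive_pt f (k (f z)) (Prf (k (f z)) Prg)).
  2:{ rewrite D; unfold Rdiv; apply Rmult_1_l. }
  apply (derivable_pt_lim_recip_interv f k (f l) (f u)); try assumption; try lra.
  - intros t Ht.
    destruct (f_interv_is_interv f l u t) as [v [Hv E]]; try lra.
    + intros w Hw; apply (continuity_01 f df w Hf); lra.
    + unfold comp, id; rewrite <- E, Hk by lra; reflexivity.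
  - rewrite D; assert (0 < df z) by (apply Hp, Hz); lra.
Qed.

(** Near f z the function H coincides with G composed with k, so the chain rule applies. *)
Lemma is_derive_along (f df k H G : R -> R) (z dG : R) :
  (forall z, 0 < z < 1 -> is_derive f z (df z)) -> (forall z, 0 < z < 1 -> 0 < df z) ->
  (forall z, 0 < z < 1 -> k (f z) = z) ->
  (forall z, 0 < z < 1 -> H (f z) = G z) ->
  0 < z < 1 -> is_derive G z dG -> is_derive H (f z) (dG / df z).
Proof.
  intros Hf Hp Hk HH Hz HG.
  apply is_derive_ext_loc with (fun t => G (k t)).
  - apply filter_imp with (2 := locally_image f df z Hf Hp Hz).
    intros t [u [Hu ->]]; rewrite Hk, HH by assumption; reflexivity.
  - replace (dG / df z) with (scal (/ df z) dG) by apply Rmult_comm.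
    apply (is_derive_comp G k).
    + rewrite Hk; assumption.
    + apply is_derive_inverse; assumption.
Qed.

(** * Complex-valued functions and the operator t d/dt *)

Lemma is_derive_C_components (f : R -> C) (t l1 l2 : R) :
  is_derive (fun u => Re (f u)) t l1 -> is_derive (fun u => Im (f u)) t l2 ->
  @is_derive R_AbsRing C_R_NormedModule f t (l1, l2).
Proof.
  intros H1 H2.
  apply (is_derive_ext (fun u => plus (scal (Re (f u)) (1, 0)) (scal (Im (f u)) (0, 1))
    : C_R_NormedModule)).
  - intros u; destruct (f u) as [c d].
    change (@eq (prod R R) (c * 1 + d * 0, c * 0 + d * 1) (c, d)); f_equal; ring.
  - replace ((l1, l2) : C_R_NormedModule) with
      (plus (scal l1 (1, 0)) (scal l2 (0, 1)) : C_R_NormedModule).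
    + apply (@is_derive_plus R_AbsRing C_R_NormedModule);
        apply (@is_derive_scal_l R_AbsRing C_R_NormedModule); assumption.
    + change (@eq (prod R R) (l1 * 1 + l2 * 0, l1 * 0 + l2 * 1) (l1, l2)); f_equal; ring.
Qed.

(** Since f' = f / U, the operator t d/dt at t = f z acts as U d/dz on functions of z. The
    derivatives are given in the form d / U so that (d1, d2) is the value of [theta H], ready to
    serve as (G1, G2) in the next application. *)
Lemma theta_along (f U k : R -> R) (H : R -> C) (G1 G2 : R -> R) (z d1 d2 : R) :
  (forall z, 0 < z < 1 -> is_derive f z (f z / U z)) ->
  (forall z, 0 < z < 1 -> 0 < f z) -> (forall z, 0 < z < 1 -> 0 < U z) ->
  (forall z, 0 < z < 1 -> k (f z) = z) ->
  (forall z, 0 < z < 1 -> H (f z) = (G1 z, G2 z)) ->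
  0 < z < 1 -> is_derive G1 z (d1 / U z) -> is_derive G2 z (d2 / U z) ->
  ex_CDerive H (f z) /\ theta H (f z) = (d1, d2).
Proof.
  intros Hf Hp HU Hk HH Hz D1 D2.
  assert (Hp' : forall z, 0 < z < 1 -> 0 < f z / U z).
  { intros u Hu; apply Rdiv_lt_0_compat; auto. }
  assert (E1 := is_derive_along f _ k (fun u => Re (H u)) G1 z _ Hf Hp' Hk
    ltac:(intros u Hu; cbv beta; rewrite HH by exact Hu; reflexivity) Hz D1).
  assert (E2 := is_derive_along f _ k (fun u => Im (H u)) G2 z _ Hf Hp' Hk
    ltac:(intros u Hu; cbv beta; rewrite HH by exact Hu; reflexivity) Hz D2).
  assert (P1 := Hp z Hz); assert (P2 := HU z Hz).
  split.
  - eexists; apply is_derive_C_components; eassumption.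
  - unfold theta, CDerive.
    rewrite (is_derive_unique _ _ _ E1), (is_derive_unique _ _ _ E2).
    unfold Cmult; simpl; f_equal; field; lra.
Qed.

(** * The mirror map *)

Definition mirror (y g : nat -> R -> R) (z : R) : R := exp (log_jet y g 0 z / y 0%nat z).

(** The logarithmic derivative is the derivative of f1 / f0, namely W / (z y^2), and W = y /
    sqrt(1-z). *)
Lemma is_derive_mirror (a : R) (y g : nat -> R -> R) (z : R) :
  frobenius_basis a y g -> 0 < z < 1 ->
  is_derive (mirror y g) z (mirror y g z / (z * y 0%nat z * sqrt (1 - z))).
Proof.
  intros H Hz.
  assert (Hy := fb_y _ _ _ H); assert (Hl := chain_log_jet y g Hy (fb_g _ _ _ H)).
  assert (Hp := fb_pos _ _ _ H z Hz).
  assert (Hs : 0 < sqrt (1 - z)) by (apply sqrt_lt_R0; lra).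
  unfold mirror at 1; auto_derive.
  - repeat split; try (apply chain_ex; assumption); lra.
  - rewrite (chain_Derive y), (chain_Derive (log_jet y g)) by assumption.
    fold (mirror y g z).
    change (exp (log_jet y g 0 z * / y 0%nat z)) with (mirror y g z).
    assert (W := wronskian_eq a y g z H Hz).
    assert (E : y 0%nat z * log_jet y g 1 z - log_jet y g 0 z * y 1%nat z = wronskian y g z).
    { unfold log_jet, wronskian; simpl pred; simpl INR; ring. }
    rewrite W in E.
    transitivity (mirror y g z / (z * y 0%nat z * y 0%nat z) *
      (y 0%nat z * log_jet y g 1 z - log_jet y g 0 z * y 1%nat z)).
    + field; lra.
    + rewrite E; field; lra.
Qed.

(** [q d/dq = theta_unit y * d/dz]. *)
Definition theta_unit (y : nat -> R -> R) (z : R) : R := z * y 0%nat z * sqrt (1 - z).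

Lemma theta_unit_pos (a : R) (y g : nat -> R -> R) (z : R) :
  frobenius_basis a y g -> 0 < z < 1 -> 0 < theta_unit y z.
Proof.
  intros H Hz; assert (Hp := fb_pos _ _ _ H z Hz).
  assert (Hs : 0 < sqrt (1 - z)) by (apply sqrt_lt_R0; lra).
  repeat apply Rmult_lt_0_compat; lra.
Qed.

(** Three successive applications of q d/dq to f / y, each derivative divided by [theta_unit] to fit
    [theta_along]. *)
Lemma theta_quotient (a : R) (h : R -> R) (y g f : nat -> R -> R) (z : R) :
  frobenius_basis a y g -> chain f -> solves a h f -> 0 < z < 1 ->
  is_derive (fun u => f 0%nat u / y 0%nat u) z
    (sqrt (1 - z) * (f 1%nat z * y 0%nat z - f 0%nat z * y 1%nat z) / y 0%nat z
       / theta_unit y z) /\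
  is_derive (fun u => sqrt (1 - u) * (f 1%nat u * y 0%nat u - f 0%nat u * y 1%nat u)
      / y 0%nat u) z (bil a y f z / theta_unit y z) /\
  is_derive (bil a y f) z
    (h z * y 0%nat z * y 0%nat z * sqrt (1 - z) / theta_unit y z).
Proof.
  intros H Hf Sf Hz.
  assert (Hp := fb_pos _ _ _ H z Hz); assert (Hy := fb_y _ _ _ H).
  assert (Hs : 0 < sqrt (1 - z)) by (apply sqrt_lt_R0; lra).
  assert (Hs2 : 1 - z = sqrt (1 - z) * sqrt (1 - z)) by (rewrite sqrt_sqrt; lra).
  unfold theta_unit; split; [|split].
  - auto_derive.
    + repeat split; try (apply chain_ex; assumption); lra.
    + rewrite (chain_Derive y), (chain_Derive f) by assumption; field; lra.
  (* Differentiation directly produces B(y, f) - (f / y) B(y, y), in which a(1-a) cancels; the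
     subtracted term is zero. *)
  - assert (Q := bil_self a y g z H Hz).
    replace (bil a y f z) with (bil a y f z - f 0%nat z / y 0%nat z * bil a y y z)
      by (rewrite Q; ring).
    clear Q; auto_derive.
    + repeat split; try (apply chain_ex; assumption); lra.
    + rewrite !(chain_Derive y), !(chain_Derive f) by assumption.
      change (1 + - z) with (1 - z).
      unfold bil; set (s := sqrt (1 - z)) in *.
      rewrite Hs2; field; lra.
  - replace (h z * y 0%nat z * y 0%nat z * sqrt (1 - z) / (z * y 0%nat z * sqrt (1 - z)))
      with (y 0%nat z * h z / z) by (field; lra).
    apply is_derive_bil; try assumption; apply H.
Qed.

(** * The inhomogeneous equation for F *)

(** [z d/dz] multiplies z^(n+x) by n + x, so these are the coefficients of its i-th iterate on F
    once z^x is split off. *)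
Definition jet_coef (a : R) (x : C) (i n : nat) : C :=
  ((RtoC (INR n) + x) ^ i * coef a x n)%C.

Definition re_coef (a : R) (x : C) (i n : nat) : R := Re (jet_coef a x i n).
Definition im_coef (a : R) (x : C) (i n : nat) : R := Im (jet_coef a x i n).

(** The summand [0 * 0] pads the right side to the four-term shape of [PSeries_lin]. *)
Lemma re_coef_S (a : R) (x : C) (i n : nat) :
  re_coef a x (S i) n =
  1 * mulN (re_coef a x i) n + Re x * re_coef a x i n + - Im x * im_coef a x i n + 0 * 0.
Proof.
  unfold re_coef, im_coef, mulN, jet_coef; simpl Cpow.
  rewrite <- Cmult_assoc; unfold Re, Im, Cmult at 1, Cplus; simpl; ring.
Qed.

Lemma im_coef_S (a : R) (x : C) (i n : nat) :
  im_coef a x (S i) n =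
  1 * mulN (im_coef a x i) n + Re x * im_coef a x i n + Im x * re_coef a x i n + 0 * 0.
Proof.
  unfold re_coef, im_coef, mulN, jet_coef; simpl Cpow.
  rewrite <- Cmult_assoc; unfold Re, Im, Cmult at 1, Cplus; simpl; ring.
Qed.

Lemma unit_disk_0 : unit_disk (fun _ => 0).
Proof.
  apply unit_disk_le with (2 := unit_disk_1); intros n.
  rewrite Rabs_R0, Rabs_R1; lra.
Qed.

Lemma unit_disk_lin (u v w t : R) (a b c d : nat -> R) :
  unit_disk a -> unit_disk b -> unit_disk c -> unit_disk d ->
  unit_disk (fun n => u * a n + v * b n + w * c n + t * d n).
Proof.
  intros Ha Hb Hc Hd; repeat apply unit_disk_plus; apply unit_disk_scal; assumption.
Qed.

Lemma im_le_Cmod (c : C) : Rabs (Im c) <= Cmod c.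
Proof. eapply Rle_trans; [apply Rmax_r|apply Rmax_Cmod]. Qed.

Lemma unit_disk_jet (a : R) (x : C) (i : nat) : 0 < a < 1 -> not_negative_integer x ->
  unit_disk (re_coef a x i) /\ unit_disk (im_coef a x i).
Proof.
  intros Ha Hx; induction i as [|i [IH1 IH2]].
  - assert (E : forall n, jet_coef a x 0 n = coef a x n).
    { intros n; unfold jet_coef; simpl; ring. }
    split; apply unit_disk_le with (2 := unit_disk_coef a x Ha Hx); intros n;
      unfold re_coef, im_coef; rewrite E, (Rabs_pos_eq (Cmod _)) by apply Cmod_ge_0;
      [apply re_le_Cmod|apply im_le_Cmod].
  - split; eapply unit_disk_ext.
    + intros n; symmetry; apply re_coef_S.
    + apply unit_disk_lin with (d := fun _ => 0); auto using unit_disk_mulN, unit_disk_0.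
    + intros n; symmetry; apply im_coef_S.
    + apply unit_disk_lin with (d := fun _ => 0); auto using unit_disk_mulN, unit_disk_0.
Qed.

(** With w = x + n, the cube (w+1)^3 cancels the denominator of the ratio. What is left is (w +
    1/2)(w + a)(w + 1 - a), expanded in powers of w. *)
Lemma jet_coef_recurrence (a : R) (x : C) (n : nat) : not_negative_integer x ->
  jet_coef a x 3 (S n) =
  (RtoC 1 * jet_coef a x 3 n + RtoC (3 / 2) * jet_coef a x 2 n +
   RtoC (a * (1 - a) + 1 / 2) * jet_coef a x 1 n + RtoC (a * (1 - a) / 2) * jet_coef a x 0 n)%C.
Proof.
  intros Hx; unfold jet_coef; rewrite coef_S by exact Hx.
  assert (H := succ_shift_neq_0 x n Hx).
  unfold ratio, factor.
  (* [field] over C would treat [RtoC (1 / 2)] as an unknown; written through 1 its value is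
     visible. *)
  assert (E2 : RtoC (1 / 2) = (/ (1 + 1))%C).
  { rewrite <- RtoC_plus, <- RtoC_inv by lra; f_equal; lra. }
  replace (3 / 2) with (1 + 1 / 2) by lra.
  replace (a * (1 - a) / 2) with (a * (1 - a) * (1 / 2)) by field.
  rewrite S_INR, !RtoC_plus, !RtoC_mult, !RtoC_minus, E2.
  field; exact H.
Qed.

Lemma re_im_coef_recurrence (a : R) (x : C) (n : nat) : not_negative_integer x ->
  re_coef a x 3 (S n) = 1 * re_coef a x 3 n + 3 / 2 * re_coef a x 2 n +
    (a * (1 - a) + 1 / 2) * re_coef a x 1 n + a * (1 - a) / 2 * re_coef a x 0 n /\
  im_coef a x 3 (S n) = 1 * im_coef a x 3 n + 3 / 2 * im_coef a x 2 n +
    (a * (1 - a) + 1 / 2) * im_coef a x 1 n + a * (1 - a) / 2 * im_coef a x 0 n.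
Proof.
  intros Hx; unfold re_coef, im_coef; rewrite jet_coef_recurrence by exact Hx.
  unfold Re, Im; split; simpl; ring.
Qed.

Lemma Rcpow_components (z : R) (x : C) :
  Rcpow z x = (exp (Re x * ln z) * cos (Im x * ln z), exp (Re x * ln z) * sin (Im x * ln z)).
Proof.
  unfold Rcpow, Cexp.
  replace (Re (x * RtoC (ln z))) with (Re x * ln z) by (unfold Re; simpl; ring).
  replace (Im (x * RtoC (ln z))) with (Im x * ln z) by (unfold Im; simpl; ring).
  reflexivity.
Qed.

Lemma is_derive_Rcpow (x : C) (z : R) : 0 < z ->
  is_derive (fun u => Re (Rcpow u x)) z ((Re x * Re (Rcpow z x) - Im x * Im (Rcpow z x)) / z) /\
  is_derive (fun u => Im (Rcpow u x)) z ((Re x * Im (Rcpow z x) + Im x * Re (Rcpow z x)) / z).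
Proof.
  intros Hz; split.
  - apply is_derive_ext with (fun u => exp (Re x * ln u) * cos (Im x * ln u)).
    { intros u; rewrite Rcpow_components; reflexivity. }
    rewrite Rcpow_components; auto_derive; [lra|]; simpl; field; lra.
  - apply is_derive_ext with (fun u => exp (Re x * ln u) * sin (Im x * ln u)).
    { intros u; rewrite Rcpow_components; reflexivity. }
    rewrite Rcpow_components; auto_derive; [lra|]; simpl; field; lra.
Qed.

Definition re_jet (a : R) (x : C) (i : nat) (z : R) : R :=
  Re (Rcpow z x) * PSeries (re_coef a x i) z - Im (Rcpow z x) * PSeries (im_coef a x i) z.

Definition im_jet (a : R) (x : C) (i : nat) (z : R) : R :=
  Re (Rcpow z x) * PSeries (im_coef a x i) z + Im (Rcpow z x) * PSeries (re_coef a x i) z.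

Lemma PSeries_jet_S (a : R) (x : C) (i : nat) (z : R) :
  0 < a < 1 -> not_negative_integer x -> 0 < z < 1 ->
  PSeries (re_coef a x (S i)) z =
    PSeries (mulN (re_coef a x i)) z + Re x * PSeries (re_coef a x i) z
    - Im x * PSeries (im_coef a x i) z /\
  PSeries (im_coef a x (S i)) z =
    PSeries (mulN (im_coef a x i)) z + Re x * PSeries (im_coef a x i) z
    + Im x * PSeries (re_coef a x i) z.
Proof.
  intros Ha Hx Hz.
  destruct (unit_disk_jet a x i Ha Hx) as [H1 H2].
  assert (Hz' : Rabs z < 1) by (rewrite Rabs_pos_eq; lra).
  rewrite (PSeries_ext _ _ z (re_coef_S a x i)), (PSeries_ext _ _ z (im_coef_S a x i)).
  rewrite !(PSeries_lin _ _ _ _ _ _ _ (fun _ => 0))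
    by auto using unit_disk_mulN, unit_disk_0.
  rewrite PSeries_const_0; split; ring.
Qed.

Lemma chain_jets (a : R) (x : C) : 0 < a < 1 -> not_negative_integer x ->
  chain (re_jet a x) /\ chain (im_jet a x).
Proof.
  intros Ha Hx.
  assert (D : forall i z, 0 < z < 1 ->
    is_derive (PSeries (re_coef a x i)) z (PSeries (mulN (re_coef a x i)) z / z) /\
    is_derive (PSeries (im_coef a x i)) z (PSeries (mulN (im_coef a x i)) z / z)).
  { intros i z Hz; destruct (unit_disk_jet a x i Ha Hx) as [H1 H2].
    split; apply is_derive_PSeries_mulN; assumption. }
  split; intros i z Hz; destruct (D i z Hz) as [D1 D2];
    destruct (is_derive_Rcpow x z) as [D3 D4]; try lra;
    destruct (PSeries_jet_S a x i z Ha Hx Hz) as [E1 E2].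
  - replace (re_jet a x (S i) z / z) with
      (minus (plus (mult ((Re x * Re (Rcpow z x) - Im x * Im (Rcpow z x)) / z)
                      (PSeries (re_coef a x i) z))
                (mult (Re (Rcpow z x)) (PSeries (mulN (re_coef a x i)) z / z)))
        (plus (mult ((Re x * Im (Rcpow z x) + Im x * Re (Rcpow z x)) / z)
                      (PSeries (im_coef a x i) z))
                (mult (Im (Rcpow z x)) (PSeries (mulN (im_coef a x i)) z / z)))).
    + apply (is_derive_minus (fun u => Re (Rcpow u x) * PSeries (re_coef a x i) u)
        (fun u => Im (Rcpow u x) * PSeries (im_coef a x i) u));
        apply (is_derive_mult (fun u => _ (Rcpow u x)) (PSeries _)); auto; exact Rmult_comm.
    + unfold re_jet; rewrite E1, E2.
      unfold minus, plus, opp, mult; simpl; field; lra.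
  - replace (im_jet a x (S i) z / z) with
      (plus (plus (mult ((Re x * Re (Rcpow z x) - Im x * Im (Rcpow z x)) / z)
                      (PSeries (im_coef a x i) z))
                (mult (Re (Rcpow z x)) (PSeries (mulN (im_coef a x i)) z / z)))
        (plus (mult ((Re x * Im (Rcpow z x) + Im x * Re (Rcpow z x)) / z)
                      (PSeries (re_coef a x i) z))
                (mult (Im (Rcpow z x)) (PSeries (mulN (re_coef a x i)) z / z)))).
    + apply (is_derive_plus (fun u => Re (Rcpow u x) * PSeries (im_coef a x i) u)
        (fun u => Im (Rcpow u x) * PSeries (re_coef a x i) u));
        apply (is_derive_mult (fun u => _ (Rcpow u x)) (PSeries _)); auto; exact Rmult_comm.
    + unfold im_jet; rewrite E1, E2.
      unfold minus, plus, opp, mult; simpl; field; lra.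
Qed.

(** The source is the index-0 coefficient x^3 of the third jet. The real coefficients let the
    equations of the two real series be recombined with Re z^x and Im z^x. *)
Lemma solves_jets (a : R) (x : C) : 0 < a < 1 -> not_negative_integer x ->
  solves a (fun z => Re (x ^ 3 * Rcpow z x)%C) (re_jet a x) /\
  solves a (fun z => Im (x ^ 3 * Rcpow z x)%C) (im_jet a x).
Proof.
  intros Ha Hx.
  assert (H0 : jet_coef a x 3 0 = (x ^ 3)%C).
  { unfold jet_coef; rewrite coef_0; simpl; ring. }
  assert (E : forall z, 0 < z < 1 ->
    (1 - z) * PSeries (re_coef a x 3) z = Re (x ^ 3)%C + z * (3 / 2 * PSeries (re_coef a x 2) z +
      (a * (1 - a) + 1 / 2) * PSeries (re_coef a x 1) z +
      a * (1 - a) / 2 * PSeries (re_coef a x 0) z) /\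
    (1 - z) * PSeries (im_coef a x 3) z = Im (x ^ 3)%C + z * (3 / 2 * PSeries (im_coef a x 2) z +
      (a * (1 - a) + 1 / 2) * PSeries (im_coef a x 1) z +
      a * (1 - a) / 2 * PSeries (im_coef a x 0) z)).
  { intros z Hz.
    assert (Hz' : Rabs z < 1) by (rewrite Rabs_pos_eq; lra).
    assert (U : forall i, unit_disk (re_coef a x i)) by (intros i; apply unit_disk_jet; assumption).
    assert (V : forall i, unit_disk (im_coef a x i)) by (intros i; apply unit_disk_jet; assumption).
    assert (E1 := PSeries_shift_lin _ _ _ _ _ _ _ _ _ z (U 3%nat) (U 3%nat) (U 2%nat) (U 1%nat)
      (U 0%nat) Hz' (fun n => proj1 (re_im_coef_recurrence a x n Hx))).
    assert (E2 := PSeries_shift_lin _ _ _ _ _ _ _ _ _ z (V 3%nat) (V 3%nat) (V 2%nat) (V 1%nat)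
      (V 0%nat) Hz' (fun n => proj2 (re_im_coef_recurrence a x n Hx))).
    unfold re_coef at 2 in E1; unfold im_coef at 2 in E2; rewrite H0 in E1, E2.
    split; lra. }
  split; intros z Hz; destruct (E z Hz) as [E1 E2]; unfold re_jet, im_jet.
  - replace (Re (x ^ 3 * Rcpow z x)%C) with
      (Re (Rcpow z x) * Re (x ^ 3)%C - Im (Rcpow z x) * Im (x ^ 3)%C)
      by (unfold Re, Im, Cmult; simpl fst; simpl snd; ring).
    rewrite Rmult_minus_distr_l.
    replace ((1 - z) * (Re (Rcpow z x) * PSeries (re_coef a x 3) z)) with
      (Re (Rcpow z x) * ((1 - z) * PSeries (re_coef a x 3) z)) by ring.
    replace ((1 - z) * (Im (Rcpow z x) * PSeries (im_coef a x 3) z)) with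
      (Im (Rcpow z x) * ((1 - z) * PSeries (im_coef a x 3) z)) by ring.
    rewrite E1, E2; ring.
  - replace (Im (x ^ 3 * Rcpow z x)%C) with
      (Re (Rcpow z x) * Im (x ^ 3)%C + Im (Rcpow z x) * Re (x ^ 3)%C)
      by (unfold Re, Im, Cmult; simpl fst; simpl snd; ring).
    rewrite Rmult_plus_distr_l.
    replace ((1 - z) * (Re (Rcpow z x) * PSeries (im_coef a x 3) z)) with
      (Re (Rcpow z x) * ((1 - z) * PSeries (im_coef a x 3) z)) by ring.
    replace ((1 - z) * (Im (Rcpow z x) * PSeries (re_coef a x 3) z)) with
      (Im (Rcpow z x) * ((1 - z) * PSeries (re_coef a x 3) z)) by ring.
    rewrite E1, E2; ring.
Qed.

(** * Expansion to second order in the parameter x *)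

(** [factor al (h + n) = factor0 al n + h * factor1 al n + O(h^2)] uniformly in [n], and likewise
    for [ratio0], [ratio1] and [coef0], [coef1]. *)
Definition factor0 (al : R) (n : nat) : R := (al + INR n) / (1 + INR n).
Definition factor1 (al : R) (n : nat) : R := (1 - al) / (1 + INR n) ^ 2.

Definition ratio0 (a : R) (n : nat) : R := factor0 (1 / 2) n * factor0 a n * factor0 (1 - a) n.

Definition ratio1 (a : R) (n : nat) : R :=
  factor0 (1 / 2) n * factor0 a n * factor1 (1 - a) n +
  (factor0 (1 / 2) n * factor1 a n + factor1 (1 / 2) n * factor0 a n) * factor0 (1 - a) n.

Fixpoint coef0 (a : R) (n : nat) : R :=
  match n with O => 1 | S m => coef0 a m * ratio0 a m end.

Fixpoint coef1 (a : R) (n : nat) : R :=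
  match n with O => 0 | S m => coef1 a m * ratio0 a m + coef0 a m * ratio1 a m end.

(** One M bounds both coefficients and the remainder, which makes the property stable under
    products. *)
Definition second_order (e M : R) (f : C -> C) (c d : R) : Prop :=
  Rabs c <= M /\ Rabs d <= M /\
  forall h, Cmod h <= e -> Cmod (f h - RtoC c - h * RtoC d) <= M * Cmod h ^ 2.

Lemma second_order_weaken (e e' M M' : R) (f : C -> C) (c d : R) :
  e' <= e -> M <= M' -> second_order e M f c d -> second_order e' M' f c d.
Proof.
  intros He HM [H1 [H2 H3]]; repeat split; try lra.
  intros h Hh; eapply Rle_trans; [apply H3; lra|].
  apply Rmult_le_compat_r; [apply pow_le, Cmod_ge_0|exact HM].
Qed.

(** For |h| <= 1/2 the three error terms are at most 2, 3/2 and 1 times M N |h|^2; their sum is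
    rounded up to 5. *)
Lemma second_order_mult (e M N : R) (f g : C -> C) (c c' d d' : R) :
  e <= 1 / 2 -> second_order e M f c d -> second_order e N g c' d' ->
  second_order e (5 * (M * N)) (fun h => f h * g h)%C (c * c') (c * d' + d * c').
Proof.
  intros He [A1 [A2 A3]] [B1 [B2 B3]].
  assert (HM : 0 <= M) by (assert (H := Rabs_pos c); lra).
  assert (HN : 0 <= N) by (assert (H := Rabs_pos c'); lra).
  assert (HMN : 0 <= M * N) by (apply Rmult_le_pos; assumption).
  assert (Q : forall u v, Rabs u <= M -> Rabs v <= N -> Rabs (u * v) <= M * N).
  { intros u v Hu Hv; rewrite Rabs_mult.
    apply Rmult_le_compat; try apply Rabs_pos; assumption. }
  split; [|split].
  - assert (H := Q c c' A1 B1); lra.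
  - assert (H := Q c d' A1 B2); assert (H' := Q d c' A2 B1).
    assert (H'' := Rabs_triang (c * d') (d * c')); lra.
  - intros h Hh; specialize (A3 h Hh); specialize (B3 h Hh).
    assert (H0 := Cmod_ge_0 h).
    replace (f h * g h - RtoC (c * c') - h * RtoC (c * d' + d * c'))%C with
      ((f h - RtoC c - h * RtoC d) * (RtoC c' + h * RtoC d' + (g h - RtoC c' - h * RtoC d'))
       + (RtoC c + h * RtoC d) * (g h - RtoC c' - h * RtoC d')
       + h * h * (RtoC d * RtoC d'))%C
      by (rewrite !RtoC_plus, !RtoC_mult; ring).
    set (E := (f h - RtoC c - h * RtoC d)%C) in *.
    set (K := (g h - RtoC c' - h * RtoC d')%C) in *.
    set (t := Cmod h) in *.
    assert (L : forall p q P, Rabs p <= P -> Rabs q <= P -> Cmod (RtoC p + h * RtoC q) <= 3 / 2 * P).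
    { intros p q P Hp Hq; eapply Rle_trans; [apply Cmod_triangle|].
      rewrite Cmod_mult, !Cmod_R; fold t.
      assert (0 <= P) by (assert (X := Rabs_pos p); lra).
      assert (t * Rabs q <= 1 / 2 * P); [|lra].
      apply Rmult_le_compat; try lra; apply Rabs_pos. }
    assert (T2 : 0 <= t ^ 2 <= 1 / 4) by nra.
    assert (X1 : Cmod (RtoC c' + h * RtoC d' + K) <= 2 * N).
    { eapply Rle_trans; [apply Cmod_triangle|].
      assert (X := L c' d' N B1 B2); nra. }
    assert (X2 := L c d M A1 A2).
    assert (X3 : Cmod (h * h * (RtoC d * RtoC d')) <= t ^ 2 * (M * N)).
    { rewrite <- RtoC_mult, !Cmod_mult, Cmod_R; fold t.
      replace (t * t) with (t ^ 2) by ring.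
      apply Rmult_le_compat_l; [lra|]; apply Q; assumption. }
    assert (X4 : Cmod (E * (RtoC c' + h * RtoC d' + K)) <= (M * t ^ 2) * (2 * N)).
    { rewrite Cmod_mult; apply Rmult_le_compat; try apply Cmod_ge_0; assumption. }
    assert (X5 : Cmod ((RtoC c + h * RtoC d) * K) <= (3 / 2 * M) * (N * t ^ 2)).
    { rewrite Cmod_mult; apply Rmult_le_compat; try apply Cmod_ge_0; assumption. }
    eapply Rle_trans; [apply Cmod_triangle|].
    eapply Rle_trans; [apply Rplus_le_compat_r, Cmod_triangle|].
    assert (0 <= t ^ 2 * (M * N)) by (apply Rmult_le_pos; lra).
    nra.
Qed.

Lemma small_not_negative_integer (h : C) : Cmod h <= 1 / 2 -> not_negative_integer h.
Proof.
  intros Hh n E; rewrite E, Cmod_R, Rabs_Ropp, Rabs_pos_eq, S_INR in Hh.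
  - assert (H := pos_INR n); lra.
  - apply pos_INR.
Qed.

Lemma factor_bounds (al : R) (n : nat) : 0 < al < 1 ->
  0 < factor0 al n <= 1 /\ 0 <= factor1 al n <= 1.
Proof.
  intros Hal; assert (H := pos_INR n); unfold factor0, factor1.
  assert (0 < / (1 + INR n)) by (apply Rinv_0_lt_compat; lra).
  assert (1 <= (1 + INR n) ^ 2) by nra.
  assert (0 < / (1 + INR n) ^ 2) by (apply Rinv_0_lt_compat; lra).
  assert (/ (1 + INR n) ^ 2 <= 1) by (rewrite <- Rinv_1; apply Rinv_le_contravar; lra).
  unfold Rdiv; split; split.
  - apply Rmult_lt_0_compat; lra.
  - apply Rmult_le_reg_r with (1 + INR n); [lra|].
    rewrite Rmult_assoc, Rinv_l; lra.
  - apply Rmult_le_pos; lra.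
  - nra.
Qed.

Lemma second_order_factor (al : R) (n : nat) : 0 < al < 1 ->
  second_order (1 / 2) 2 (fun h => factor al (h + RtoC (INR n))) (factor0 al n) (factor1 al n).
Proof.
  intros Hal; destruct (factor_bounds al n Hal) as [F0 F1].
  assert (Hn := pos_INR n).
  split; [|split]; [rewrite Rabs_pos_eq; lra|rewrite Rabs_pos_eq; lra|].
  intros h Hh.
  assert (Hw := succ_shift_neq_0 h n (small_not_negative_integer h Hh)).
  assert (Hc := Cmod_succ_shift h n).
  assert (HN : (1 + RtoC (INR n))%C <> RtoC 0).
  { rewrite <- RtoC_plus; intros E; apply RtoC_inj in E; lra. }
  (* The remainder is exact: 1/(1+n+h) minus its first-order expansion is h^2 / ((1+n)^2 (1+n+h)).
     The last denominator has modulus at least 1/2, whence the constant 2. *)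
  replace (factor al (h + RtoC (INR n)) - RtoC (factor0 al n) - h * RtoC (factor1 al n))%C with
    (- (h ^ 2 * RtoC (factor1 al n) / (1 + (h + RtoC (INR n)))))%C.
  - rewrite Cmod_opp, Cmod_div, Cmod_mult, Cmod_pow, Cmod_R, Rabs_pos_eq by (auto; lra).
    assert (0 <= Cmod h ^ 2) by (apply pow_le, Cmod_ge_0).
    assert (/ Cmod (1 + (h + RtoC (INR n))) <= 2).
    { replace 2 with (/ (1 / 2)) by field; apply Rinv_le_contravar; lra. }
    assert (0 < / Cmod (1 + (h + RtoC (INR n)))) by (apply Rinv_0_lt_compat; lra).
    unfold Rdiv; rewrite (Rmult_comm 2).
    apply Rmult_le_compat; try lra; [apply Rmult_le_pos; lra|nra].
  - unfold factor, factor0, factor1.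
    rewrite !RtoC_div by nra; rewrite RtoC_pow, RtoC_minus, !RtoC_plus.
    field; auto.
Qed.

(** Two products of factors with constant 2 give 5 (5 (2 * 2) * 2) = 200, uniformly in n. *)
Lemma second_order_ratio (a : R) (n : nat) : 0 < a < 1 ->
  second_order (1 / 2) 200 (fun h => ratio a (h + RtoC (INR n))) (ratio0 a n) (ratio1 a n).
Proof.
  intros Ha.
  assert (F1 := second_order_factor (1 / 2) n ltac:(lra)).
  assert (F2 := second_order_factor a n Ha).
  assert (F3 := second_order_factor (1 - a) n ltac:(lra)).
  assert (H := second_order_mult _ _ _ _ _ _ _ _ _ (Rle_refl _)
    (second_order_mult _ _ _ _ _ _ _ _ _ (Rle_refl _) F1 F2) F3).
  eapply second_order_weaken; [apply Rle_refl| |exact H]; lra.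
Qed.

Lemma ratio0_bounds (a : R) (n : nat) : 0 < a < 1 -> 0 < ratio0 a n <= 1.
Proof.
  intros Ha.
  destruct (factor_bounds (1 / 2) n ltac:(lra)) as [F1 _].
  destruct (factor_bounds a n Ha) as [F2 _].
  destruct (factor_bounds (1 - a) n ltac:(lra)) as [F3 _].
  assert (P : 0 < factor0 (1 / 2) n * factor0 a n <= 1) by nra.
  unfold ratio0; nra.
Qed.

Lemma coef0_bounds (a : R) (n : nat) : 0 < a < 1 -> 0 < coef0 a n <= 1.
Proof.
  intros Ha; induction n as [|n IH]; simpl; [lra|].
  assert (H := ratio0_bounds a n Ha); nra.
Qed.

Lemma coef1_bound (a : R) (n : nat) : 0 < a < 1 -> Rabs (coef1 a n) <= 200 * INR n.
Proof.
  intros Ha; induction n as [|n IH].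
  - simpl; rewrite Rabs_R0; lra.
  - rewrite S_INR; simpl.
    destruct (second_order_ratio a n Ha) as [_ [R1 _]].
    assert (R0 := ratio0_bounds a n Ha); assert (C0 := coef0_bounds a n Ha).
    eapply Rle_trans; [apply Rabs_triang|].
    rewrite !Rabs_mult, (Rabs_pos_eq (ratio0 a n)), (Rabs_pos_eq (coef0 a n)) by lra.
    assert (H := Rabs_pos (coef1 a n)); assert (H' := Rabs_pos (ratio1 a n)); nra.
Qed.

Lemma unit_disk_coef0 (a : R) : 0 < a < 1 -> unit_disk (coef0 a).
Proof.
  intros Ha; apply unit_disk_le with (2 := unit_disk_1); intros n.
  assert (H := coef0_bounds a n Ha); rewrite Rabs_R1, Rabs_pos_eq; lra.
Qed.

Lemma unit_disk_coef1 (a : R) : 0 < a < 1 -> unit_disk (coef1 a).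
Proof.
  intros Ha; apply unit_disk_le with (fun n => 200 * mulN (fun _ => 1) n).
  - intros n; unfold mulN; rewrite Rmult_1_r, (Rabs_pos_eq (200 * INR n)).
    + apply coef1_bound, Ha.
    + assert (H := pos_INR n); lra.
  - apply unit_disk_scal, unit_disk_mulN, unit_disk_1.
Qed.

Lemma coef_at_0 (a : R) (n : nat) : coef a 0 n = RtoC (coef0 a n).
Proof.
  induction n as [|n IH]; [apply coef_0|].
  assert (H0 : not_negative_integer 0).
  { apply small_not_negative_integer; rewrite Cmod_0; lra. }
  assert (Hn := pos_INR n).
  rewrite coef_S, IH by exact H0; simpl coef0; rewrite RtoC_mult; f_equal.
  assert (E : forall al, factor al (0 + RtoC (INR n)) = RtoC (factor0 al n)).
  { intros al; unfold factor, factor0; rewrite RtoC_div, !RtoC_plus, Cplus_0_l by lra.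
    reflexivity. }
  unfold ratio, ratio0; rewrite !E, !RtoC_mult; reflexivity.
Qed.

(** The rate 1 + 300 e can be brought as close to 1 as desired by shrinking e, which keeps the sum
    over n finite for any fixed z < 1. *)
Lemma coef_expansion (a e : R) (h : C) (n : nat) :
  0 < a < 1 -> 0 <= e <= 1 / 2 -> Cmod h <= e ->
  Cmod (coef a h n - RtoC (coef0 a n) - h * RtoC (coef1 a n)) <=
  60000 * INR n ^ 2 * (1 + 300 * e) ^ n * Cmod h ^ 2.
Proof.
  intros Ha He Hh.
  assert (H0 := Cmod_ge_0 h).
  assert (Hx : not_negative_integer h) by (apply small_not_negative_integer; lra).
  induction n as [|n IH].
  - rewrite coef_0; simpl coef0; simpl coef1.
    replace (RtoC 1 - RtoC 1 - h * RtoC 0)%C with (RtoC 0) by ring.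
    rewrite Cmod_0; simpl; lra.
  - rewrite coef_S by exact Hx; simpl coef0; simpl coef1.
    destruct (second_order_ratio a n Ha) as [R1 [R2 R3]].
    specialize (R3 h ltac:(lra)).
    assert (Hr0 := ratio0_bounds a n Ha).
    set (A := coef a h n) in *; set (R := ratio a (h + RtoC (INR n))) in *.
    set (E := (A - RtoC (coef0 a n) - h * RtoC (coef1 a n))%C) in *.
    set (K := (R - RtoC (ratio0 a n) - h * RtoC (ratio1 a n))%C) in *.
    set (t := Cmod h) in *.
    (* 200 t + 200 t^2 <= 300 t because t <= 1/2. *)
    assert (HRd : Cmod (h * RtoC (ratio1 a n) + K) <= 300 * t).
    { eapply Rle_trans; [apply Cmod_triangle|]; rewrite Cmod_mult, Cmod_R; fold t.
      assert (t * Rabs (ratio1 a n) <= t * 200) by (apply Rmult_le_compat_l; assumption).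
      nra. }
    assert (HR : Cmod R <= 1 + 300 * e).
    { replace R with (RtoC (ratio0 a n) + (h * RtoC (ratio1 a n) + K))%C by (unfold K; ring).
      eapply Rle_trans; [apply Cmod_triangle|].
      rewrite Cmod_R, Rabs_pos_eq; lra. }
    replace (A * R - RtoC (coef0 a n * ratio0 a n)
       - h * RtoC (coef1 a n * ratio0 a n + coef0 a n * ratio1 a n))%C with
      (E * R + RtoC (coef0 a n) * K + h * RtoC (coef1 a n) * (h * RtoC (ratio1 a n) + K))%C
      by (unfold E, K; rewrite !RtoC_plus, !RtoC_mult; ring).
    assert (C0 := coef0_bounds a n Ha); assert (C1 := coef1_bound a n Ha).
    eapply Rle_trans; [apply Cmod_triangle|].
    eapply Rle_trans; [apply Rplus_le_compat_r, Cmod_triangle|].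
    set (r := 1 + 300 * e) in *.
    assert (Hr : 1 <= r) by (unfold r; lra).
    assert (Hrn : 1 <= r ^ n) by (apply pow_R1_Rle; exact Hr).
    assert (Hn := pos_INR n).
    assert (X1 : Cmod (E * R) <= (60000 * INR n ^ 2 * r ^ n * t ^ 2) * r).
    { rewrite Cmod_mult; apply Rmult_le_compat; try apply Cmod_ge_0; assumption. }
    assert (X2 : Cmod (RtoC (coef0 a n) * K) <= 1 * (200 * t ^ 2)).
    { rewrite Cmod_mult, Cmod_R, Rabs_pos_eq by lra.
      apply Rmult_le_compat; try apply Cmod_ge_0; lra. }
    (* This cross term dictates the constant: 200 n from [coef1_bound] times 300 is 60000 n. *)
    assert (X3 : Cmod (h * RtoC (coef1 a n) * (h * RtoC (ratio1 a n) + K))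
                 <= (t * (200 * INR n)) * (300 * t)).
    { rewrite !Cmod_mult, Cmod_R; fold t.
      apply Rmult_le_compat; try apply Cmod_ge_0; try assumption.
      - apply Rmult_le_pos; [exact H0|apply Rabs_pos].
      - apply Rmult_le_compat_l; assumption. }
    rewrite S_INR; simpl pow.
    assert (Y : INR n + 1 <= (INR n + 1) * (r * r ^ n)).
    { rewrite <- (Rmult_1_r (INR n + 1)) at 1; apply Rmult_le_compat_l; [lra|nra]. }
    assert (T2 : 0 <= t ^ 2) by nra.
    assert (Z : 60000 * (INR n ^ 2 * (r * r ^ n) + (INR n + 1)) * t ^ 2 <=
      60000 * ((INR n + 1) ^ 2 * (r * r ^ n)) * t ^ 2).
    { apply Rmult_le_compat_r; [exact T2|].
      assert (0 <= INR n * (r * r ^ n)) by (apply Rmult_le_pos; nra). nra. }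
    simpl pow in Z, X1, X2, T2 |- *. nra.
Qed.

(** * Second-order expansion of z^x in x *)

Lemma mean_value_0 (f df : R -> R) (v : R) :
  f 0 = 0 -> (forall u, is_derive f u (df u)) ->
  exists c, Rabs c <= Rabs v /\ f v = df c * v.
Proof.
  intros H0 Hf.
  destruct (MVT_gen f 0 v df) as [c [Hc E]].
  - intros u _; apply Hf.
  - intros u _; apply continuity_pt_filterlim, (ex_derive_continuous f).
    exists (df u); apply Hf.
  - exists c; split; [|lra].
    unfold Rmin, Rmax in Hc; destruct (Rle_dec 0 v).
    + rewrite !Rabs_pos_eq; lra.
    + rewrite !Rabs_left1; lra.
Qed.

Lemma sin_cos_bounds (v : R) :
  Rabs (sin v) <= Rabs v /\ Rabs (cos v - 1) <= Rabs v ^ 2 /\ Rabs (sin v - v) <= Rabs v ^ 2.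
Proof.
  assert (S1 : forall c, Rabs (sin c) <= Rabs c).
  { intros c; destruct (mean_value_0 sin cos c sin_0 is_derive_sin) as [d [_ ->]].
    rewrite Rabs_mult.
    assert (Hd : Rabs (cos d) <= 1) by (apply Rabs_le, COS_bound).
    assert (H := Rabs_pos c); nra. }
  assert (C : forall c, exists d, Rabs d <= Rabs c /\ cos c - 1 = - sin d * c).
  { intros c; apply (mean_value_0 (fun u => cos u - 1) (fun u => - sin u)).
    - rewrite cos_0; ring.
    - intros u; auto_derive; [exact I|ring]. }
  split; [apply S1|split].
  - destruct (C v) as [d [Hd ->]]; rewrite Rabs_mult, Rabs_Ropp.
    assert (H := S1 d); assert (H' := Rabs_pos v); nra.
  - destruct (mean_value_0 (fun u => sin u - u) (fun u => cos u - 1) v) as [c [Hc ->]].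
    + rewrite sin_0; ring.
    + intros u; auto_derive; [exact I|ring].
    + destruct (C c) as [d [Hd ->]]; rewrite !Rabs_mult, Rabs_Ropp.
      assert (Hs : Rabs (sin d) <= 1) by (apply Rabs_le, SIN_bound).
      assert (H := Rabs_pos (sin d)); assert (H' := Rabs_pos v); assert (H'' := Rabs_pos c).
      assert (Rabs (sin d) * Rabs c <= 1 * Rabs v) by (apply Rmult_le_compat; lra).
      nra.
Qed.

Lemma exp_le_compat (u v : R) : u <= v -> exp u <= exp v.
Proof. intros [H| ->]; [left; apply exp_increasing, H|right; reflexivity]. Qed.

Lemma exp_bounds (u B : R) : Rabs u <= B ->
  exp u <= exp B /\ Rabs (exp u - 1) <= Rabs u * exp B /\
  Rabs (exp u - 1 - u) <= Rabs u ^ 2 * exp B.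
Proof.
  intros Hu.
  assert (HB : 1 <= exp B).
  { rewrite <- exp_0; apply exp_le_compat; assert (H := Rabs_pos u); lra. }
  assert (HuB : exp u <= exp B) by (apply exp_le_compat; assert (H := Rle_abs u); lra).
  assert (E1 := exp_ineq1_le u); assert (E2 := exp_ineq1_le (- u)).
  assert (E3 := exp_pos u).
  assert (E4 : exp u - 1 <= u * exp u).
  { assert (H : exp (- u) * exp u = 1) by (rewrite <- exp_plus, <- exp_0; f_equal; ring).
    assert (H' := Rmult_le_compat_r (exp u) _ _ (Rlt_le _ _ E3) E2); lra. }
  assert (X : Rabs (exp u - 1) <= Rabs u * exp B).
  { destruct (Rle_dec 0 u).
    - rewrite !Rabs_pos_eq by lra; nra.
    - assert (exp u - 1 <= 0) by nra.
      rewrite !Rabs_left1 by lra; nra. }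
  split; [exact HuB|split; [exact X|]].
  rewrite Rabs_pos_eq by lra.
  apply Rle_trans with (Rabs u * Rabs (exp u - 1)).
  - rewrite <- Rabs_mult; eapply Rle_trans; [|apply Rle_abs]; lra.
  - assert (H := Rabs_pos u); simpl pow; nra.
Qed.

Lemma Cmod_le_components (c : C) : Cmod c <= Rabs (Re c) + Rabs (Im c).
Proof.
  replace c with (RtoC (Re c) + Ci * RtoC (Im c))%C at 1.
  - eapply Rle_trans; [apply Cmod_triangle|].
    rewrite Cmod_mult, !Cmod_R, Cmod_Ci; lra.
  - destruct c as [u v]; unfold RtoC, Ci, Cplus, Cmult, Re, Im; simpl; f_equal; ring.
Qed.

Lemma second_order_Rcpow (z : R) :
  exists M, second_order (1 / 2) M (fun h => Rcpow z h) 1 (ln z).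
Proof.
  set (L := ln z); set (B := Rabs L).
  assert (HB0 : 0 <= B) by apply Rabs_pos.
  assert (HB1 : 1 <= exp B) by (rewrite <- exp_0; apply exp_le_compat; exact HB0).
  (* The real and imaginary parts of the remainder split into four quadratic pieces, each at most
     B^2 exp B |h|^2. *)
  exists (1 + B + 4 * B ^ 2 * exp B).
  assert (HB2 : 0 <= B ^ 2 * exp B) by (apply Rmult_le_pos; [apply pow_le, HB0|lra]).
  split; [|split].
  - rewrite Rabs_R1; lra.
  - fold B; lra.
  - intros h Hh; rewrite Rcpow_components; fold L.
    set (t := Cmod h) in *.
    assert (Ht : 0 <= t) by apply Cmod_ge_0.
    assert (Hu : Rabs (Re h * L) <= t * B).
    { rewrite Rabs_mult; apply Rmult_le_compat_r; [exact HB0|apply re_le_Cmod]. }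
    assert (Hv : Rabs (Im h * L) <= t * B).
    { rewrite Rabs_mult; apply Rmult_le_compat_r; [exact HB0|apply im_le_Cmod]. }
    set (u := Re h * L) in *; set (v := Im h * L) in *.
    destruct (exp_bounds u B) as [X1 [X2 X3]]; [nra|].
    destruct (sin_cos_bounds v) as [Y1 [Y2 Y3]].
    assert (E0 := exp_pos u).
    assert (U0 := Rabs_pos u); assert (V0 := Rabs_pos v).
    assert (U2 : Rabs u ^ 2 <= t ^ 2 * B ^ 2) by (rewrite <- Rpow_mult_distr; apply pow_incr; lra).
    assert (V2 : Rabs v ^ 2 <= t ^ 2 * B ^ 2) by (rewrite <- Rpow_mult_distr; apply pow_incr; lra).
    assert (UV : Rabs u * Rabs v <= t ^ 2 * B ^ 2).
    { replace (t ^ 2 * B ^ 2) with ((t * B) * (t * B)) by ring.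
      apply Rmult_le_compat; assumption. }
    eapply Rle_trans; [apply Cmod_le_components|].
    replace (Re ((exp u * cos v, exp u * sin v) - RtoC 1 - h * RtoC L)) with
      ((exp u - 1 - u) + exp u * (cos v - 1)) by (unfold u, Re; simpl; ring).
    replace (Im ((exp u * cos v, exp u * sin v) - RtoC 1 - h * RtoC L)) with
      ((exp u - 1) * sin v + (sin v - v)) by (unfold v, Im; simpl; ring).
    assert (Z1 := Rabs_triang (exp u - 1 - u) (exp u * (cos v - 1))).
    assert (Z2 := Rabs_triang ((exp u - 1) * sin v) (sin v - v)).
    rewrite Rabs_mult, (Rabs_pos_eq (exp u)) in Z1 by lra.
    rewrite Rabs_mult in Z2.
    set (Q := t ^ 2 * B ^ 2) in *.
    assert (HQ : 0 <= Q) by (apply Rmult_le_pos; apply pow_le; assumption).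
    assert (W1 : exp u * Rabs (cos v - 1) <= exp B * Q).
    { apply Rmult_le_compat; try apply Rabs_pos; lra. }
    assert (W2 : Rabs (exp u - 1) * Rabs (sin v) <= exp B * Q).
    { apply Rle_trans with ((Rabs u * exp B) * Rabs v).
      - apply Rmult_le_compat; try apply Rabs_pos; lra.
      - replace (Rabs u * exp B * Rabs v) with (exp B * (Rabs u * Rabs v)) by ring.
        apply Rmult_le_compat_l; lra. }
    assert (W3 : Rabs u ^ 2 * exp B <= exp B * Q).
    { rewrite Rmult_comm; apply Rmult_le_compat_l; lra. }
    assert (W4 : Q <= exp B * Q) by nra.
    assert (W5 : (1 + B + 4 * B ^ 2 * exp B) * t ^ 2 = (1 + B) * t ^ 2 + 4 * (exp B * Q))
      by (unfold Q; ring).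
    assert (0 <= (1 + B) * t ^ 2) by (apply Rmult_le_pos; [lra|apply pow_le, Ht]).
    lra.
Qed.

(** * Second-order expansion of the series and the derivative at x = 0 *)

Lemma PSeries_abs_le (d K : nat -> R) (z : R) : 0 <= z ->
  (forall n, Rabs (d n) <= K n) -> ex_series (fun n => K n * z ^ n) ->
  Rabs (PSeries d z) <= Series (fun n => K n * z ^ n).
Proof.
  intros Hz HK Hex; unfold PSeries.
  assert (B : forall n, 0 <= Rabs (d n * z ^ n) <= K n * z ^ n).
  { intros n; split; [apply Rabs_pos|].
    rewrite Rabs_mult, (Rabs_pos_eq (z ^ n)) by (apply pow_le, Hz).
    apply Rmult_le_compat_r; [apply pow_le, Hz|apply HK]. }
  eapply Rle_trans; [apply Series_Rabs|apply Series_le; assumption].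
  apply (@ex_series_le R_AbsRing R_CompleteNormedModule) with (2 := Hex).
  intros n; change (Rabs (Rabs (d n * z ^ n)) <= K n * z ^ n).
  rewrite Rabs_Rabsolu; apply B.
Qed.

Definition coef_series (a : R) (z : R) (x : C) : C :=
  (PSeries (re_coef a x 0) z, PSeries (im_coef a x 0) z).

Lemma second_order_coef_series (a z : R) : 0 < a < 1 -> 0 < z < 1 ->
  exists e M, 0 < e <= 1 / 2 /\
  second_order e M (coef_series a z) (PSeries (coef0 a) z) (PSeries (coef1 a) z).
Proof.
  intros Ha Hz.
  assert (Hz1 : 1 < / z) by (rewrite <- Rinv_1; apply Rinv_lt_contravar; lra).
  (* Then 300 e <= (1/z - 1)/2, so (1 + 300 e) z <= (1 + z)/2 < 1. *)
  set (e := Rmin (1 / 2) ((/ z - 1) / 600)).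
  assert (He0 : 0 < e) by (apply Rmin_glb_lt; lra).
  assert (He1 : e <= 1 / 2) by apply Rmin_l.
  assert (He2 : e <= (/ z - 1) / 600) by apply Rmin_r.
  set (r := 1 + 300 * e).
  assert (Hrz : 0 <= r * z < 1).
  { assert (r <= 1 + (/ z - 1) / 2) by (unfold r; lra).
    assert (/ z * z = 1) by (apply Rinv_l; lra).
    split; [apply Rmult_le_pos; unfold r; lra|nra]. }
  set (k := fun n => INR n ^ 2 * r ^ n).
  assert (Hk : ex_series (fun n => k n * z ^ n)).
  { apply ex_series_ext with (2 := unit_disk_mulN _ (unit_disk_mulN _ unit_disk_1) (r * z) Hrz).
    intros n; unfold mulN, k; rewrite Rabs_pos_eq.
    - simpl; rewrite Rpow_mult_distr; ring.
    - assert (H := pos_INR n); repeat apply Rmult_le_pos; try lra.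
      apply pow_le; lra. }
  set (S := Series (fun n => k n * z ^ n)).
  assert (HS : 0 <= S).
  { eapply Rle_trans; [apply Rabs_pos|apply (PSeries_abs_le (fun _ => 0)); [lra| |exact Hk]].
    intros n; rewrite Rabs_R0; apply Rmult_le_pos; apply pow_le; [apply pos_INR|unfold r; lra]. }
  (* 120000 is 60000 for the real part plus 60000 for the imaginary part. *)
  exists e; exists (Rabs (PSeries (coef0 a) z) + Rabs (PSeries (coef1 a) z) + 120000 * S).
  assert (P0 := Rabs_pos (PSeries (coef0 a) z)); assert (P1 := Rabs_pos (PSeries (coef1 a) z)).
  split; [lra|split; [lra|split; [lra|]]].
  intros h Hh.
  assert (Hx : not_negative_integer h) by (apply small_not_negative_integer; lra).
  destruct (unit_disk_jet a h 0 Ha Hx) as [U1 U2].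
  assert (U3 := unit_disk_coef0 a Ha); assert (U4 := unit_disk_coef1 a Ha).
  assert (Hz' : Rabs z < 1) by (rewrite Rabs_pos_eq; lra).
  assert (Ht : 0 <= Cmod h ^ 2) by (apply pow_le, Cmod_ge_0).
  assert (HE : forall n, Cmod (jet_coef a h 0 n - RtoC (coef0 a n) - h * RtoC (coef1 a n)) <=
    60000 * Cmod h ^ 2 * k n).
  { intros n.
    replace (jet_coef a h 0 n) with (coef a h n) by (unfold jet_coef; simpl; ring).
    eapply Rle_trans; [apply (coef_expansion a e); lra|].
    right; unfold k, r; ring. }
  assert (B : forall d : nat -> R, (forall n, Rabs (d n) <= 60000 * Cmod h ^ 2 * k n) ->
    Rabs (PSeries d z) <= 60000 * Cmod h ^ 2 * S).
  { intros d Hd.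
    assert (Ex : Series (fun n => 60000 * Cmod h ^ 2 * k n * z ^ n) = 60000 * Cmod h ^ 2 * S).
    { unfold S; rewrite <- Series_scal_l; apply Series_ext; intros n; ring. }
    rewrite <- Ex; apply PSeries_abs_le; [lra|exact Hd|].
    apply ex_series_ext with (fun n => 60000 * Cmod h ^ 2 * (k n * z ^ n)).
    - intros n; symmetry; apply Rmult_assoc.
    - apply (ex_series_scal_l (60000 * Cmod h ^ 2) (fun n => k n * z ^ n)), Hk. }
  assert (B1 := B (fun n => 1 * re_coef a h 0 n + -1 * coef0 a n + - Re h * coef1 a n + 0 * 0)
    ltac:(intros n; eapply Rle_trans; [|apply (HE n)]; eapply Rle_trans; [|apply re_le_Cmod];
      right; f_equal; unfold re_coef, Re; simpl; ring)).
  assert (B2 := B (fun n => 1 * im_coef a h 0 n + 0 * coef0 a n + - Im h * coef1 a n + 0 * 0)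
    ltac:(intros n; eapply Rle_trans; [|apply (HE n)]; eapply Rle_trans; [|apply im_le_Cmod];
      right; f_equal; unfold im_coef, Im; simpl; ring)).
  rewrite (PSeries_lin _ _ _ _ _ _ _ (fun _ => 0)) in B1 by auto using unit_disk_0.
  rewrite (PSeries_lin _ _ _ _ _ _ _ (fun _ => 0)) in B2 by auto using unit_disk_0.
  eapply Rle_trans; [apply Cmod_le_components|].
  replace (Re (coef_series a z h - RtoC (PSeries (coef0 a) z) - h * RtoC (PSeries (coef1 a) z)))
    with (1 * PSeries (re_coef a h 0) z + -1 * PSeries (coef0 a) z +
          - Re h * PSeries (coef1 a) z + 0 * PSeries (fun _ => 0) z)
    by (unfold coef_series, Re; simpl; ring).
  replace (Im (coef_series a z h - RtoC (PSeries (coef0 a) z) - h * RtoC (PSeries (coef1 a) z)))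
    with (1 * PSeries (im_coef a h 0) z + 0 * PSeries (coef0 a) z +
          - Im h * PSeries (coef1 a) z + 0 * PSeries (fun _ => 0) z)
    by (unfold coef_series, Im; simpl; ring).
  assert (0 <= (Rabs (PSeries (coef0 a) z) + Rabs (PSeries (coef1 a) z)) * Cmod h ^ 2)
    by (apply Rmult_le_pos; lra).
  lra.
Qed.

Lemma is_derive_second_order (e M : R) (f : C -> C) (c d : R) : 0 < e ->
  second_order e M f c d -> @is_derive C_AbsRing C_NormedModule f (RtoC 0) (RtoC d).
Proof.
  intros He [H1 [H2 H3]].
  assert (HM : 0 <= M) by (assert (X := Rabs_pos c); lra).
  assert (Hf0 : f (RtoC 0) = RtoC c).
  { assert (H := H3 (RtoC 0)); rewrite Cmod_0 in H; specialize (H ltac:(lra)).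
    rewrite Cmult_0_l in H.
    assert (E : (f (RtoC 0) - RtoC c - RtoC 0)%C = RtoC 0).
    { apply Cmod_eq_0; assert (X := Cmod_ge_0 (f (RtoC 0) - RtoC c - RtoC 0)); simpl in H; lra. }
    replace (f (RtoC 0)) with ((f (RtoC 0) - RtoC c - RtoC 0) + RtoC c)%C by ring.
    rewrite E; ring. }
  split.
  - apply (is_linear_scal_l (K := C_AbsRing) (V := C_NormedModule)).
  - intros x Hx.
    apply (is_filter_lim_locally_unique (V := AbsRing_NormedModule C_AbsRing)) in Hx; subst x.
    intros eps.
    assert (He' := cond_pos eps).
    set (d0 := Rmin e (eps / (M + 1))).
    assert (Hd : 0 < d0) by (apply Rmin_glb_lt; [exact He|apply Rdiv_lt_0_compat; lra]).
    exists (mkposreal _ Hd); intros h Hb.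
    change (Cmod (h - RtoC 0) < d0) in Hb.
    assert (E0 : (h - RtoC 0)%C = h) by (change C in (type of h); ring).
    rewrite E0 in Hb.
    assert (D1 : d0 <= e) by apply Rmin_l.
    assert (D2 : d0 <= eps / (M + 1)) by apply Rmin_r.
    change (Cmod ((f h - f (RtoC 0)) - (h - RtoC 0) * RtoC d) <= eps * Cmod (h - RtoC 0)).
    rewrite Hf0.
    rewrite E0; eapply Rle_trans; [apply H3; lra|].
    assert (X := Cmod_ge_0 h).
    assert (M * Cmod h <= eps).
    { apply Rle_trans with ((M + 1) * (eps / (M + 1))).
      - apply Rmult_le_compat; lra.
      - right; field; lra. }
    replace (M * Cmod h ^ 2) with (M * Cmod h * Cmod h) by ring.
    apply Rmult_le_compat_r; assumption.
Qed.

(** * The Frobenius basis at z = 0 *)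

(** The i-th iterate of [z d/dz] on the series with coefficients c; [INR 0 ^ 0 = 1] makes i = 0 the
    series itself. *)
Definition pow_jet (c : nat -> R) (i : nat) (z : R) : R :=
  PSeries (fun n => INR n ^ i * c n) z.

Lemma unit_disk_pow (c : nat -> R) (i : nat) :
  unit_disk c -> unit_disk (fun n => INR n ^ i * c n).
Proof.
  intros Hc; induction i as [|i IH].
  - apply unit_disk_ext with (2 := Hc); intros n; simpl; ring.
  - apply unit_disk_ext with (2 := unit_disk_mulN _ IH); intros n; unfold mulN; simpl; ring.
Qed.

Lemma chain_pow_jet (c : nat -> R) : unit_disk c -> chain (pow_jet c).
Proof.
  intros Hc i z Hz.
  replace (pow_jet c (S i) z) with (PSeries (mulN (fun n => INR n ^ i * c n)) z).
  - apply is_derive_PSeries_mulN; [apply unit_disk_pow, Hc|exact Hz].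
  - apply PSeries_ext; intros n; unfold mulN; simpl; ring.
Qed.

Lemma continuity_pow_jet (c : nat -> R) (i : nat) :
  unit_disk c -> continuity_pt (pow_jet c i) 0.
Proof.
  intros Hc; apply PSeries_continuity, unit_disk_radius; [apply unit_disk_pow, Hc|].
  rewrite Rabs_R0; lra.
Qed.

Lemma pow_jet_0 (c : nat -> R) (i : nat) : pow_jet c i 0 = INR 0 ^ i * c 0%nat.
Proof. unfold pow_jet; rewrite PSeries_0; reflexivity. Qed.

Lemma frobenius_pow_jets (a : R) : 0 < a < 1 ->
  frobenius_basis a (pow_jet (coef0 a)) (pow_jet (coef1 a)).
Proof.
  intros Ha.
  assert (U := unit_disk_coef0 a Ha); assert (V := unit_disk_coef1 a Ha).
  assert (U' := fun i => unit_disk_pow _ i U); assert (V' := fun i => unit_disk_pow _ i V).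
  assert (Z0 := unit_disk_0).
  split; try (intros i; apply continuity_pow_jet; assumption);
    try (apply chain_pow_jet; assumption).
  - intros z Hz.
    assert (Hz' : Rabs z < 1) by (rewrite Rabs_pos_eq; lra).
    assert (E := PSeries_shift_lin 1 (3 / 2) (a * (1 - a) + 1 / 2) (a * (1 - a) / 2)
      _ _ _ _ _ z (U' 3%nat) (U' 3%nat) (U' 2%nat) (U' 1%nat) (U' 0%nat) Hz').
    cbv beta in E; fold (pow_jet (coef0 a) 3 z) (pow_jet (coef0 a) 2 z)
      (pow_jet (coef0 a) 1 z) (pow_jet (coef0 a) 0 z) in E.
    assert (E' := E ltac:(intros n; assert (Hn := pos_INR n); simpl coef0;
      unfold ratio0, factor0; rewrite S_INR; field; lra)).
    (* The index-0 coefficient carries 0^3, so there is no source. *)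
    rewrite INR_0, pow_i, Rmult_0_l in E' by lia; lra.
  - intros z Hz.
    assert (Hz' : Rabs z < 1) by (rewrite Rabs_pos_eq; lra).
    (* This is the derivative in x at 0 of (n + x)^i times the coefficient, so the sequences c
       satisfy the same recurrence as the jets of F. *)
    set (c := fun (i : nat) n => INR n ^ i * coef1 a n + INR i * (INR n ^ (pred i) * coef0 a n)).
    assert (L : forall i, unit_disk (c i) /\
      PSeries (c i) z = pow_jet (coef1 a) i z + INR i * pow_jet (coef0 a) (pred i) z).
    { intros i.
      assert (X : forall n, 1 * (INR n ^ i * coef1 a n) + INR i * (INR n ^ (pred i) * coef0 a n)
        + 0 * 0 + 0 * 0 = c i n) by (intros n; unfold c; ring).
      split.
      - apply unit_disk_ext with (1 := X).
        apply (unit_disk_lin 1 (INR i) 0 0 _ _ (fun _ => 0) (fun _ => 0)); auto.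
      - rewrite <- (PSeries_ext _ _ z X).
        rewrite (PSeries_lin 1 (INR i) 0 0 _ _ (fun _ => 0) (fun _ => 0)); auto.
        unfold pow_jet; ring. }
    assert (E := PSeries_shift_lin 1 (3 / 2) (a * (1 - a) + 1 / 2) (a * (1 - a) / 2)
      _ _ _ _ _ z (proj1 (L 3%nat)) (proj1 (L 3%nat)) (proj1 (L 2%nat)) (proj1 (L 1%nat))
      (proj1 (L 0%nat)) Hz').
    rewrite (proj2 (L 3%nat)), (proj2 (L 2%nat)), (proj2 (L 1%nat)), (proj2 (L 0%nat)) in E.
    simpl pred in E.
    replace (INR 3) with 3 in E by (simpl; ring).
    replace (INR 2) with 2 in E by (simpl; ring).
    rewrite INR_1, INR_0 in E.
    (* The derivative of the source x^3 vanishes at x = 0. *)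
    replace (c 3%nat 0%nat) with 0 in E by (unfold c; simpl; ring).
    assert (E' := E ltac:(intros n; assert (Hn := pos_INR n); unfold c; simpl coef0; simpl coef1;
      unfold ratio1, ratio0, factor0, factor1; simpl pred;
      rewrite S_INR; simpl INR; field; lra)).
    lra.
  - rewrite pow_jet_0; simpl; ring.
  - intros i; rewrite pow_jet_0; simpl; ring.
  - intros i; rewrite pow_jet_0; simpl; ring.
  - intros z Hz.
    apply Rlt_le_trans with (INR 0 ^ 0 * coef0 a 0); [simpl; lra|].
    apply (PSeries_nonneg (fun n => INR n ^ 0 * coef0 a n)); [apply U'| |lra].
    intros n; apply Rmult_le_pos; [apply pow_le, pos_INR|].
    assert (H := coef0_bounds a n Ha); lra.
Qed.

(** * Identification with F and the mirror map, and conclusion *)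

Lemma inv_INR_bounds (s : nat) : (2 <= s)%nat -> 0 < 1 / INR s < 1.
Proof.
  intros Hs; apply le_INR in Hs; simpl in Hs.
  split; [apply Rdiv_lt_0_compat; lra|].
  apply Rmult_lt_reg_r with (INR s); [lra|field_simplify; lra].
Qed.

Lemma F_term_components (s : nat) (x : C) (z : R) (n : nat) : (2 <= s)%nat ->
  F_term s x z n =
  (Re (Rcpow z x) * (re_coef (1 / INR s) x 0 n * z ^ n)
     - Im (Rcpow z x) * (im_coef (1 / INR s) x 0 n * z ^ n),
   Re (Rcpow z x) * (im_coef (1 / INR s) x 0 n * z ^ n)
     + Im (Rcpow z x) * (re_coef (1 / INR s) x 0 n * z ^ n)).
Proof.
  intros Hs; apply le_INR in Hs; simpl in Hs.
  assert (E : F_term s x z n = (RtoC (z ^ n) * Rcpow z x * jet_coef (1 / INR s) x 0 n)%C).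
  { unfold F_term, jet_coef, coef.
    replace ((INR s - 1) / INR s) with (1 - 1 / INR s) by (field; lra).
    simpl (_ ^ 0)%C; rewrite Cmult_1_l; reflexivity. }
  rewrite E; unfold re_coef, im_coef, Re, Im, Cmult; simpl; f_equal; ring.
Qed.

Lemma ex_series_jet_coef (a : R) (x : C) (z : R) :
  0 < a < 1 -> not_negative_integer x -> 0 < z < 1 ->
  ex_series (fun n => re_coef a x 0 n * z ^ n) /\ ex_series (fun n => im_coef a x 0 n * z ^ n).
Proof.
  intros Ha Hx Hz; destruct (unit_disk_jet a x 0 Ha Hx) as [H1 H2].
  split; apply ex_pseries_R, unit_disk_ex; try assumption; rewrite Rabs_pos_eq; lra.
Qed.

Lemma ex_series_C_components (f : nat -> C) :
  ex_series (fun n => Re (f n)) -> ex_series (fun n => Im (f n)) ->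
  @ex_series C_AbsRing C_NormedModule f.
Proof.
  intros [l1 H1] [l2 H2]; exists (l1, l2).
  assert (E : forall n, sum_n (G := C_NormedModule) f n =
    (sum_n (fun k => Re (f k)) n, sum_n (fun k => Im (f k)) n)).
  { induction n as [|n IH].
    - rewrite !sum_O; destruct (f 0%nat); reflexivity.
    - rewrite !sum_Sn, IH; destruct (f (S n)); reflexivity. }
  intros P [d HP].
  assert (X1 : eventually (fun n => ball l1 d (sum_n (fun k => Re (f k)) n))).
  { apply H1; exists d; auto. }
  assert (X2 : eventually (fun n => ball l2 d (sum_n (fun k => Im (f k)) n))).
  { apply H2; exists d; auto. }
  apply filter_imp with (2 := filter_and _ _ X1 X2).
  intros n [Y1 Y2]; apply HP; rewrite E; split; assumption.
Qed.

Lemma ex_series_F_term (s : nat) (x : C) (z : R) :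
  (2 <= s)%nat -> not_negative_integer x -> 0 < z < 1 ->
  @ex_series C_AbsRing C_NormedModule (F_term s x z).
Proof.
  intros Hs Hx Hz.
  destruct (ex_series_jet_coef _ x z (inv_INR_bounds s Hs) Hx Hz) as [H1 H2].
  apply ex_series_C_components; eapply ex_series_ext.
  - intros n; rewrite F_term_components by exact Hs; reflexivity.
  - apply (ex_series_minus (V := R_NormedModule)); apply (ex_series_scal_l (V := R_NormedModule));
      assumption.
  - intros n; rewrite F_term_components by exact Hs; reflexivity.
  - apply (ex_series_plus (V := R_NormedModule)); apply (ex_series_scal_l (V := R_NormedModule));
      assumption.
Qed.

Lemma F_jets (s : nat) (x : C) (z : R) :
  (2 <= s)%nat -> not_negative_integer x -> 0 < z < 1 ->
  F s x z = (re_jet (1 / INR s) x 0 z, im_jet (1 / INR s) x 0 z).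
Proof.
  intros Hs Hx Hz.
  destruct (ex_series_jet_coef _ x z (inv_INR_bounds s Hs) Hx Hz) as [H1 H2].
  unfold F, CSeries, re_jet, im_jet, PSeries.
  rewrite <- !Series_scal_l.
  rewrite <- Series_minus, <- Series_plus
    by (apply (ex_series_scal_l (V := R_NormedModule)); assumption).
  f_equal; apply Series_ext; intros n; rewrite F_term_components by exact Hs; reflexivity.
Qed.

Lemma F_factor (s : nat) (x : C) (z : R) :
  (2 <= s)%nat -> not_negative_integer x -> 0 < z < 1 ->
  F s x z = (Rcpow z x * coef_series (1 / INR s) z x)%C.
Proof.
  intros Hs Hx Hz; rewrite F_jets by assumption.
  unfold re_jet, im_jet, coef_series, Re, Im, Cmult; simpl; f_equal; ring.
Qed.

Lemma not_negative_integer_0 : not_negative_integer 0.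
Proof. apply small_not_negative_integer; rewrite Cmod_0; lra. Qed.

Lemma F_at_0 (s : nat) (z : R) : (2 <= s)%nat -> 0 < z < 1 ->
  F s 0 z = RtoC (pow_jet (coef0 (1 / INR s)) 0 z).
Proof.
  intros Hs Hz; rewrite F_factor by (assumption || apply not_negative_integer_0).
  assert (E : coef_series (1 / INR s) z 0 = RtoC (pow_jet (coef0 (1 / INR s)) 0 z)).
  { unfold coef_series, pow_jet, RtoC; f_equal.
    - apply PSeries_ext; intros n; unfold re_coef, jet_coef; rewrite coef_at_0.
      unfold Re; simpl; ring.
    - eapply eq_trans; [|apply (PSeries_const_0 z)]; apply PSeries_ext; intros n.
      unfold im_coef, jet_coef; rewrite coef_at_0; unfold Im; simpl; ring. }
  rewrite E, Rcpow_components; unfold Re, Im; simpl fst; simpl snd.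
  rewrite Rmult_0_l, exp_0, cos_0, sin_0, Rmult_1_l, Rmult_0_r.
  apply Cmult_1_l.
Qed.

(** F is z^x times a series; multiplying the two second-order expansions gives the product rule,
    with ln z coming from z^x and g from the series. *)
Lemma is_derive_F (s : nat) (z : R) : (2 <= s)%nat -> 0 < z < 1 ->
  @is_derive C_AbsRing C_NormedModule (fun x => F s x z) (RtoC 0)
    (RtoC (log_jet (pow_jet (coef0 (1 / INR s))) (pow_jet (coef1 (1 / INR s))) 0 z)).
Proof.
  intros Hs Hz.
  destruct (second_order_coef_series _ z (inv_INR_bounds s Hs) Hz) as [e [M [He H]]].
  destruct (second_order_Rcpow z) as [N HN].
  assert (HN' := second_order_weaken _ e _ N _ _ _ (proj2 He) (Rle_refl _) HN).
  assert (HP := second_order_mult _ _ _ _ _ _ _ _ _ (proj2 He) HN' H).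
  replace (log_jet (pow_jet (coef0 (1 / INR s))) (pow_jet (coef1 (1 / INR s))) 0 z) with
    (1 * PSeries (coef1 (1 / INR s)) z + ln z * PSeries (coef0 (1 / INR s)) z).
  - apply is_derive_second_order with (1 := proj1 He) (M := 5 * (N * M))
      (c := 1 * PSeries (coef0 (1 / INR s)) z).
    destruct HP as [H1 [H2 H3]]; split; [exact H1|split; [exact H2|]].
    intros h Hh; rewrite F_factor; [apply H3, Hh|exact Hs| |exact Hz].
    apply small_not_negative_integer; lra.
  - assert (E : forall c, pow_jet c 0 z = PSeries c z).
    { intros c; apply PSeries_ext; intros n; simpl; ring. }
    unfold log_jet; simpl pred; rewrite !E, INR_0; ring.
Qed.

Lemma qC_mirror (s : nat) (z : R) : (2 <= s)%nat -> 0 < z < 1 ->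
  qC s z = RtoC (mirror (pow_jet (coef0 (1 / INR s))) (pow_jet (coef1 (1 / INR s))) z).
Proof.
  intros Hs Hz.
  assert (Hp := fb_pos _ _ _ (frobenius_pow_jets _ (inv_INR_bounds s Hs)) z Hz).
  assert (E := is_C_derive_unique (fun x => F s x z) _ _ (is_derive_F s z Hs Hz)).
  unfold qC; rewrite E, F_at_0 by assumption.
  rewrite <- RtoC_div by lra.
  unfold Cexp, mirror, Re, Im, RtoC; simpl fst; simpl snd.
  rewrite cos_0, sin_0, Rmult_1_r, Rmult_0_r; reflexivity.
Qed.

Theorem theorem2 (s : nat) (hs : s = 2%nat \/ s = 3%nat \/ s = 4%nat \/ s = 6%nat)
  (x : C) (hx : not_negative_integer x) :
  well_defined s /\
  forall zq : R -> R, inverse_mirror s zq ->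
  forall z : R, 0 < z < 1 ->
  let q0 := q s z in
  let f := phi s x zq in
  ex_derive zq q0 /\
  ex_CDerive f q0 /\ ex_CDerive (theta f) q0 /\ ex_CDerive (theta (theta f)) q0 /\
  theta (theta (theta f)) q0 =
    (x ^ 3 * Rcpow z x / RtoC (sqrt (1 - z)) * RtoC (q0 / z * Derive zq q0) ^ 2)%C /\
  (x ^ 3 * Rcpow z x / RtoC (sqrt (1 - z)) * RtoC (q0 / z * Derive zq q0) ^ 2)%C =
    (x ^ 3 * F s 0 z ^ 2 * RtoC (sqrt (1 - z)) * Rcpow z x)%C.
Proof.
  assert (Hs : (2 <= s)%nat) by lia.
  set (a := 1 / INR s); assert (Ha : 0 < a < 1) by apply (inv_INR_bounds s Hs).
  set (y := pow_jet (coef0 a)); set (g := pow_jet (coef1 a)); set (U := theta_unit y).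
  assert (FB : frobenius_basis a y g) by apply (frobenius_pow_jets a Ha).
  assert (Hq : forall z, 0 < z < 1 -> q s z = mirror y g z).
  { intros z Hz; unfold q; rewrite qC_mirror by assumption; reflexivity. }
  assert (Hm : forall z, 0 < z < 1 -> is_derive (mirror y g) z (mirror y g z / U z))
    by (intros z Hz; apply (is_derive_mirror a); assumption).
  assert (Hm0 : forall z, 0 < z < 1 -> 0 < mirror y g z) by (intros; apply exp_pos).
  assert (HU : forall z, 0 < z < 1 -> 0 < U z)
    by (intros z Hz; apply (theta_unit_pos a y g); assumption).
  assert (Hm' : forall z, 0 < z < 1 -> 0 < mirror y g z / U z)
    by (intros z Hz; apply Rdiv_lt_0_compat; auto).
  split.
  - split; [|split].
    + intros w z Hw Hz; apply ex_series_F_term; assumption.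
    + intros z Hz; split; [|split; [|split]].
      * eexists; apply is_derive_F; assumption.
      * rewrite F_at_0 by assumption; intros E; apply RtoC_inj in E.
        assert (Hp := fb_pos _ _ _ FB z Hz); unfold y, a in Hp; lra.
      * rewrite Hq, qC_mirror by assumption; reflexivity.
      * rewrite Hq by exact Hz; apply exp_pos.
    + intros z1 z2 Hz1 Hz2; rewrite !Hq by assumption; intros E.
      assert (Inc := increasing_01 _ _ Hm Hm').
      destruct (Rtotal_order z1 z2) as [L|[L|L]]; [|exact L|].
      * assert (X := Inc z1 z2 ltac:(lra) L ltac:(lra)); lra.
      * assert (X := Inc z2 z1 ltac:(lra) L ltac:(lra)); lra.
  - intros zq Hzq z Hz; cbv zeta.
    assert (Hk : forall z, 0 < z < 1 -> zq (mirror y g z) = z).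
    { intros u Hu; rewrite <- Hq by exact Hu; apply Hzq, Hu. }
    rewrite Hq by exact Hz.
    destruct (chain_jets a x Ha hx) as [C1 C2].
    destruct (solves_jets a x Ha hx) as [S1 S2].
    assert (D1 := fun u Hu => theta_quotient a _ y g _ u FB C1 S1 Hu).
    assert (D2 := fun u Hu => theta_quotient a _ y g _ u FB C2 S2 Hu).
    assert (Hphi : forall u, 0 < u < 1 -> phi s x zq (mirror y g u) =
      (re_jet a x 0 u / y 0%nat u, im_jet a x 0 u / y 0%nat u)).
    { intros u Hu; unfold phi; rewrite Hk, F_jets, F_at_0 by assumption.
      fold a; fold y; assert (Hp := fb_pos _ _ _ FB u Hu).
      unfold Cdiv; rewrite <- RtoC_inv by lra.
      unfold Cmult, RtoC; simpl; f_equal; field; lra. }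
    (* Each application of T yields the value of [theta] at every point of the image, which is the
       hypothesis that the next application needs. *)
    assert (T := theta_along (mirror y g) U zq).
    assert (T1 := fun u Hu => T _ _ _ u _ _ Hm Hm0 HU Hk Hphi Hu
      (proj1 (D1 u Hu)) (proj1 (D2 u Hu))).
    assert (T2 := fun u Hu => T _ _ _ u _ _ Hm Hm0 HU Hk (fun v Hv => proj2 (T1 v Hv)) Hu
      (proj1 (proj2 (D1 u Hu))) (proj1 (proj2 (D2 u Hu)))).
    assert (T3 := fun u Hu => T _ _ _ u _ _ Hm Hm0 HU Hk (fun v Hv => proj2 (T2 v Hv)) Hu
      (proj2 (proj2 (D1 u Hu))) (proj2 (proj2 (D2 u Hu)))).
    assert (Dz := is_derive_inverse _ _ zq z Hm Hm' Hk Hz).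
    assert (Hp := fb_pos _ _ _ FB z Hz); assert (HUz := HU z Hz); assert (Hmz := Hm0 z Hz).
    assert (Hsq : 0 < sqrt (1 - z)) by (apply sqrt_lt_R0; lra).
    assert (Hsq' : RtoC (sqrt (1 - z)) <> RtoC 0) by (intros E; apply RtoC_inj in E; lra).
    rewrite (is_derive_unique _ _ _ Dz).
    (* As dz/dq = U / q with U = z y sqrt(1-z), the quantity (q/z) dz/dq is y sqrt(1-z). Its square
       over sqrt(1-z) is y^2 sqrt(1-z), which links the two closed forms. *)
    replace (mirror y g z / z * / (mirror y g z / U z)) with (y 0%nat z * sqrt (1 - z))
      by (unfold U, theta_unit in *; field; repeat split; lra).
    rewrite F_at_0 by assumption; fold a; fold y.
    assert (E : (x ^ 3 * Rcpow z x / RtoC (sqrt (1 - z)) * RtoC (y 0%nat z * sqrt (1 - z)) ^ 2)%C =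
      (x ^ 3 * RtoC (y 0%nat z) ^ 2 * RtoC (sqrt (1 - z)) * Rcpow z x)%C).
    { rewrite RtoC_mult; field; exact Hsq'. }
    split; [eexists; exact Dz|].
    split; [apply (T1 z Hz)|split; [apply (T2 z Hz)|split; [apply (T3 z Hz)|split; [|exact E]]]].
    rewrite E, (proj2 (T3 z Hz)).
    replace (x ^ 3 * RtoC (y 0%nat z) ^ 2 * RtoC (sqrt (1 - z)) * Rcpow z x)%C with
      (x ^ 3 * Rcpow z x * RtoC (y 0%nat z * y 0%nat z * sqrt (1 - z)))%C
      by (rewrite !RtoC_mult; ring).
    set (w := (x ^ 3 * Rcpow z x)%C).
    destruct w as [w1 w2]; unfold Re, Im, RtoC, Cmult; simpl; f_equal; ring.
Qed.
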